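(* For every triple $(A,\mathfrak{n},L)$ as in the context, the ring $R(A,\mathfrak{n},L)$ is a normal complete intersection of dimension $$\dim R(A,\mathfrak{n},L)=n-r+1,\qquad n:=n_0+\cdots+n_r.$$
   Context: $\mathbb{K}$ is an algebraically closed field of characteristic zero. Let $A=(a_0,\ldots,a_r)$ be a sequence of vectors $a_i\in\mathbb{K}^2$ with $(a_i,a_k)$ linearly independent whenever $k\ne i$, let $\mathfrak{n}=(n_0,\ldots,n_r)$ be a sequence of positive integers and $L=(l_{ij})$ a family of positive integers, $0\le i\le r$, $1\le j\le n_i$. Put $f_i:=T_{i1}^{l_{i1}}\cdots T_{in_i}^{l_{in_i}}$, $\alpha_{ij}:=\det(a_i,a_j)$ and, for $0\le i<j<k\le r$, $g_{i,j,k}:=\alpha_{jk}f_i+\alpha_{ki}f_j+\alpha_{ij}f_k$ in $\mathbb{K}[T_{ij};\,0\le i\le r,\,1\le j\le n_i]$. Then $$R(A,\mathfrak{n},L):=\mathbb{K}[T_{ij};\,0\le i\le r,\,1\le j\le n_i]\,/\,\langle g_{i,i+1,i+2};\,0\le i\le r-2\rangle .$$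
   Formalization: The formal theorem assumes r ≥ 1; for r = 0 there are no relations, the ring is a polynomial ring in n variables of dimension n, and the stated formula n − r + 1 = n + 1 fails. *)

(* Defs.v *)
From HB Require Import structures.
From mathcomp Require Import all_boot all_order all_algebra.
From mathcomp Require Import boolp mpoly.

Set Implicit Arguments.
Unset Strict Implicit.
Unset Printing Implicit Defensive.

Import GRing.Theory.
Local Open Scope ring_scope.
Local Open Scope quotient_scope.

Section CommutativeAlgebra.

Definition ideal_span (S : comNzRingType) (m : nat) (g : 'I_m -> S) (x : S) : bool :=
  `[< exists c : 'I_m -> S, x = \sum_(k < m) c k * g k >].

(* Ideals are boolean predicates in MathComp; in classical logic (which is    *)
(* needed anyway for [ideal_span]) these are all the ideals.                  *)
Definition prime_chain (S : comNzRingType) (d : nat) (p : 'I_d.+1 -> prime_idealr S) : Prop :=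
  forall i j : 'I_d.+1, (i < j)%N ->
    {subset p i <= p j} /\ exists2 x, x \in p j & x \notin p i.

Definition krull_dim (S : comNzRingType) (d : nat) : Prop :=
  (exists p : 'I_d.+1 -> prime_idealr S, prime_chain p) /\
  (forall (e : nat) (p : 'I_e.+1 -> prime_idealr S), prime_chain p -> (e <= d)%N).

Definition is_fraction_field (S : comNzRingType) (F : fieldType)
    (phi : {rmorphism S -> F}) : Prop :=
  injective phi /\ forall x : F, exists a b : S, b != 0 /\ x = phi a / phi b.

(* The field of fractions is only determined up to isomorphism, so it enters  *)
(* through its defining property; it exists for every integral domain         *)
(* ([{fraction _}] in MathComp, for structures of type [idomainType]).        *)
Definition normal_domain (S : comNzRingType) : Prop :=
  GRing.integral_domain_axiom S /\
  forall (F : fieldType) (phi : {rmorphism S -> F}), is_fraction_field phi ->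
    forall x : F, integralOver phi x -> exists a : S, x = phi a.

(* [S], a K-algebra through [iota], has a presentation K[T_1..T_N]/<h_1..h_c> *)
(* by as many relations as its codimension.                                   *)
Definition complete_intersection (K : fieldType) (S : comNzRingType) (iota : K -> S) : Prop :=
  exists (N c : nat) (h : 'I_c -> {mpoly K[N]}) (phi : {rmorphism {mpoly K[N]} -> S}),
    [/\ forall a : K, phi a%:MP = iota a,
        forall y : S, exists p, phi p = y,
        forall p, phi p = 0 <-> ideal_span h p
      & exists2 d : nat, krull_dim S d & (d + c)%N = N].

Lemma ideal_span_closed (S : comNzRingType) (m : nat) (g : 'I_m -> S) :
  1 \notin (ideal_span g : {pred S}) -> idealr_closed (ideal_span g).
Proof.
move=> n1; split=> // [|a x y].
  by apply/asboolP; exists (fun=> 0); rewrite big1 // => k _; rewrite mul0r.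
move=> /asboolP[c ->] /asboolP[c' ->]; apply/asboolP.
exists (fun k => a * c k + c' k).
rewrite mulr_sumr -big_split /=; apply: eq_bigr => k _.
by rewrite mulrDl mulrA.
Qed.

End CommutativeAlgebra.

(* The blocks are indexed by 0 <= i <= r; inside a block the index j runs     *)
(* over 0 <= j < n_i instead of 1 <= j <= n_i.                                *)
Record trinomial_data (K : fieldType) (r : nat) := TrinomialData {
  vec : 'I_r.+1 -> 'cV[K]_2;
  blk : 'I_r.+1 -> nat;
  expo : forall i : 'I_r.+1, 'I_(blk i) -> nat;
  vec_free : forall i k : 'I_r.+1, k != i -> free [:: vec i; vec k];
  blk_gt0 : forall i : 'I_r.+1, (0 < blk i)%N;
  expo_gt0 : forall (i : 'I_r.+1) (j : 'I_(blk i)), (0 < expo j)%N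
}.

Section TrinomialRing.

Variables (K : fieldType) (r : nat) (t : trinomial_data K r).

Definition nvars : nat := (\sum_(i < r.+1) blk t i)%N.

Local Notation P := {mpoly K[nvars]}.

Definition Tvar (i : 'I_r.+1) (j : 'I_(blk t i)) : P := 'X_(tagnat.Rank i j).

Definition monom (i : 'I_r.+1) : P := \prod_(j < blk t i) Tvar j ^+ expo j.

Definition alpha (i j : 'I_r.+1) : K := \det (row_mx (vec t i) (vec t j)).

Definition trinom (i j k : 'I_r.+1) : P :=
  alpha j k *: monom i + alpha k i *: monom j + alpha i j *: monom k.

(* For i < r.-1 the numbers i, i.+1, i.+2 are at most r, so [inord] returns   *)
(* the ordinals with these values.                                            *)
Definition relation (i : 'I_r.-1) : P := trinom (inord i) (inord i.+1) (inord i.+2).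

Definition relation_ideal : P -> bool := ideal_span relation.

Lemma monom_at0 (i : 'I_r.+1) : (monom i).@[fun=> 0] = 0.
Proof.
rewrite /monom rmorph_prod /= (bigD1 (Ordinal (blk_gt0 t i))) //=.
by rewrite rmorphXn /= mevalXU expr0n eqn0Ngt expo_gt0 mul0r.
Qed.

Lemma relation_ideal_closed : idealr_closed relation_ideal.
Proof.
apply: ideal_span_closed; apply/negP => /asboolP[c /(congr1 (meval (fun=> 0)))].
rewrite meval1 raddf_sum big1 => [|k _] /=; first by apply/eqP; rewrite oner_eq0.
by rewrite mevalM /relation /trinom !mevalD !mevalZ !monom_at0 !mulr0 !addr0 mulr0.
Qed.

HB.instance Definition _ := isIdealr.Build P relation_ideal relation_ideal_closed.

Definition trinomial_ring : comNzRingType :=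
  {ideal_quot [the idealr P of relation_ideal]}.

Definition trinomial_scalar (a : K) : trinomial_ring :=
  \pi_({ideal_quot [the idealr P of relation_ideal]}) a%:MP.

End TrinomialRing.

Arguments expo {K r} t i j.
Arguments Tvar {K r} t i j.
Arguments relation_ideal {K r} t p.

(* Main.v *)
Require Import Defs.
From HB Require Import structures.
From mathcomp Require Import all_boot all_order all_algebra all_solvable all_field.
From mathcomp Require Import boolp mpoly ring zify.

Set Implicit Arguments.
Unset Strict Implicit.
Unset Printing Implicit Defensive.

Import GRing.Theory.
Local Open Scope ring_scope.
Local Open Scope quotient_scope.

(** Idea of the proof.

    Write f_i for the monomials of the presentation.  Since the alpha_ij are the
    2 x 2 minors of (a_0, ..., a_r), the relations say that the f_i are the values
    of pairwise independent linear forms at one point of the plane: in R one has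
    f_i = x_i f_0 + y_i f_1 with explicit scalars ([pencilX], [pencilY],
    [trinomial_proj_monom]), and a map from R to a ring A is the same as a choice
    of values with this property ([trinomial_lift]).  So R arises from the plane
    by adjoining variables T_ij with prod_j T_ij^l_ij equal to a linear form.

    Normality.  Complete integral closedness is a statement about divisibility
    inside the ring: w divides y as soon as, for some c <> 0, every w^N
    divides c y^N.  It implies normality ([cic_normal_domain]), passes to
    polynomial rings ([cic_poly]), and passes to direct summands: if w and y lie
    in the summand and y = q w in the big ring, the retraction turns q into a
    quotient inside the summand.  Let M be a common multiple of the exponents.
    Setting T_ij = S_ij^(M/l_ij) embeds R as a direct summand into a ring where
    all exponents equal M ([root_retract], [trinomial_summand]).  That ring is
    built from a polynomial ring in two variables ([trinomial_cover]) by
    - extracting M-th roots z of the linear forms p.  These are not units and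
      generate radical ideals; for such a p a proper factor of z^M - p would make
      p a unit, so B[z]/(z^M - p) is a domain ([coprime_pure]), and the rotations
      z -> zeta z reduce almost integral elements to the form b z^i, where the
      radical ideal pB decides ([pure_cic]);
    - splitting z into a product uv.  In B[u,v]/(uv - z) the elements u, v form a
      regular sequence, and inverting one of them gives a Laurent polynomial ring
      over B, so that completeness of B is inherited ([split_cic]).

    Dimension.  If p_0 < ... < p_e is a chain of primes and x_i lies in p_(i+1)
    but not in p_i, then the x_i are algebraically independent
    ([chain_independent]).  On the other hand give T_ij a weight for which all
    the f_i have the same weight.  Monomials divisible by no f_i with i >= 2 span
    R, and there are O(D^(n-r+1)) of weight at most D ([card_standard]); hence
    e <= n - r + 1.  A chain of that length starts with 0 and the kernel of a
    parametrization of a component of T_00 = 0 ([divisor_map]); then the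
    parameters are set to zero one after the other ([trinomial_chain]).

    With the dimension known, the presentation of R by r - 1 relations in n
    variables exhibits R as a complete intersection. *)

(** * Domains and completely integrally closed rings *)

Definition divides (S : comNzRingType) (w y : S) : Prop := exists q, y = q * w.

(** A domain is completely integrally closed if it contains every element y/w
    of its field of fractions whose powers have a common denominator c; here this
    is expressed by divisibility inside the ring. *)
Definition completely_closed (S : comNzRingType) : Prop := forall c y w : S,
  c != 0 -> w != 0 -> (forall N, divides (w ^+ N) (c * y ^+ N)) -> divides w y.

Definition domain (S : comNzRingType) : Prop := GRing.integral_domain_axiom S.

Section Domain.
Variable S : comNzRingType.
Hypothesis domS : domain S.

Lemma domain_mulf_neq0 (x y : S) : x != 0 -> y != 0 -> x * y != 0.
Proof. by move=> x0 y0; apply/eqP=> /domS; rewrite (negPf x0) (negPf y0). Qed.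

Lemma domain_expf_neq0 (x : S) n : x != 0 -> x ^+ n != 0.
Proof.
move=> x0; elim: n => [|n IH]; first by rewrite expr0 oner_neq0.
by rewrite exprS domain_mulf_neq0.
Qed.

Lemma domain_mulfI (w : S) : w != 0 -> injective ( *%R w).
Proof.
move=> w0 x y e; apply/eqP; rewrite -subr_eq0.
have /domS/orP[] // : w * (x - y) = 0 by rewrite mulrBr e subrr.
by rewrite (negPf w0).
Qed.

End Domain.

Section DomainType.
Variable S : comNzRingType.
Hypothesis domS : domain S.

(** Deciding invertibility classically turns any domain into an [idomainType] on
    the same carrier. *)
Definition domain_type of domain S : Type := S.
Local Notation D := (domain_type domS).
HB.instance Definition _ := GRing.ComNzRing.copy D S.

Definition dom_unit (x : D) : bool := `[< exists y, y * x = 1 >].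
Definition dom_inv (x : D) : D :=
  if pselect (exists y, y * x = 1) is left h then projT1 (cid h) else x.

Fact dom_mulVx : {in dom_unit, left_inverse 1 dom_inv *%R}.
Proof.
move=> x; rewrite unfold_in /dom_unit /dom_inv; case: pselect => [h _|h /asboolP //].
exact: projT2 (cid h).
Qed.

Fact dom_unitP (x y : D) : y * x = 1 -> dom_unit x.
Proof. by move=> h; apply/asboolP; exists y. Qed.

Fact dom_inv_out : {in [predC dom_unit], dom_inv =1 id}.
Proof.
move=> x; rewrite inE unfold_in /dom_unit /dom_inv.
by case: pselect => // h /asboolP.
Qed.

HB.instance Definition _ :=
  GRing.ComNzRing_hasMulInverse.Build D dom_mulVx dom_unitP dom_inv_out.
HB.instance Definition _ := GRing.ComUnitRing_isIntegral.Build D domS.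
Definition idomain_of : idomainType := D.
End DomainType.

(** Transfers to rings that are only known to be domains what the polynomial
    division theory proves for [idomainType]s. *)
Lemma domainW (P : comNzRingType -> Prop) :
  (forall B : idomainType, P B) -> forall S, domain S -> P S.
Proof.
move=> H S domS; move: (H (idomain_of domS)).
(* Once S is destructed, both ring structures on its carrier are convertible. *)
by case: S domS => T [].
Qed.

Lemma idomain_domain (B : idomainType) : domain B.
Proof. by move=> x y /eqP; rewrite mulf_eq0. Qed.

Lemma cic_field (F : fieldType) : completely_closed F.
Proof. by move=> c y w _ w0 _; exists (y / w); rewrite divfK. Qed.

(** If x = a/b is a root of a monic polynomial of degree d, then b^d is a common
    denominator of all powers of x. *)
Lemma cic_normal_domain (S : comNzRingType) : domain S -> completely_closed S -> normal_domain S.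
Proof.
move=> domS cicS; split=> // F phi [phiI phiF] x [p p_monic p_x].
have [a [b [b0 xE]]] := phiF x.
have phib0 : phi b != 0 by apply: contraNneq b0 => e; apply/eqP/phiI; rewrite e rmorph0.
pose d := (size p).-1.
have sp : size p = d.+1 by rewrite prednK // size_poly_gt0 monic_neq0.
have xd : x ^+ d = - \sum_(i < d) phi p`_i * x ^+ i.
  move: p_x; rewrite /root horner_coef size_map_poly_id0; last first.
    by rewrite (monicP p_monic) rmorph1 oner_eq0.
  rewrite sp big_ord_recr /= !coef_map /=.
  have -> : p`_d = 1 by move/monicP: p_monic; rewrite /lead_coef sp.
  rewrite rmorph1 mul1r addrC addr_eq0 => /eqP ->; congr (- _).
  by apply: eq_bigr => i _; rewrite coef_map.
have bx N : exists z, phi b ^+ d * x ^+ N = phi z.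
  elim/ltn_ind: N => N IH; have [ltNd|ledN] := ltnP N d.
    exists (b ^+ (d - N) * a ^+ N); rewrite rmorphM !rmorphXn xE expr_div_n.
    rewrite -[in LHS](subnK (ltnW ltNd)) exprD -!mulrA; congr (_ * _).
    by rewrite mulrC divfK // expf_neq0.
  have {}IH (i : 'I_d) : exists z, phi b ^+ d * x ^+ (N - d + i) = phi z.
    by apply: IH; rewrite -ltn_subRL (leq_trans (ltn_ord i)) // subKn.
  pose z i := projT1 (cid (IH i)).
  exists (- \sum_(i < d) p`_i * z i).
  rewrite -[in LHS](subnK ledN) exprD xd mulrN mulrN rmorphN; congr (- _).
  rewrite !mulr_sumr rmorph_sum; apply: eq_bigr => i _.
  rewrite rmorphM -(projT2 (cid (IH i))) exprD; ring.
have [|||q aE] := @cicS (b ^+ d) a b => //; first exact: domain_expf_neq0.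
  move=> N; have [z zE] := bx N; exists z; apply: phiI.
  rewrite !rmorphM !rmorphXn -zE xE expr_div_n -[in RHS]mulrA; congr (_ * _).
  by rewrite divfK // expf_neq0.
by exists q; rewrite xE aE rmorphM mulfK.
Qed.

(** * Almost integral elements *)

Section Divides.
Variable S : comNzRingType.
Implicit Types x y w c a b : S.

Lemma divides_refl x : divides x x. Proof. by exists 1; rewrite mul1r. Qed.

Lemma divides0 x : divides x 0. Proof. by exists 0; rewrite mul0r. Qed.

Lemma dividesD w x y : divides w x -> divides w y -> divides w (x + y).
Proof. by move=> [a ->] [b ->]; exists (a + b); rewrite mulrDl. Qed.

Lemma divides_sum (I : Type) (r : seq I) (P : pred I) w (F : I -> S) :
  (forall i, P i -> divides w (F i)) -> divides w (\sum_(i <- r | P i) F i).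
Proof.
by move=> H; elim/big_rec: _ => [|i x Pi]; [exact: divides0|apply/dividesD/H].
Qed.

Lemma divides_mull w x y : divides w x -> divides w (y * x).
Proof. by move=> [a ->]; exists (y * a); rewrite mulrA. Qed.

Lemma divides_mulr w x y : divides w x -> divides w (x * y).
Proof. by rewrite mulrC; apply: divides_mull. Qed.

Lemma divides_mul w v x y : divides w x -> divides v y -> divides (w * v) (x * y).
Proof. by move=> [a ->] [b ->]; exists (a * b); ring. Qed.

Lemma divides_exp_le w m n : (m <= n)%N -> divides (w ^+ m) (w ^+ n).
Proof. by move=> le; exists (w ^+ (n - m)); rewrite -exprD subnK. Qed.

Lemma divides_rmorph (T : comNzRingType) (f : {rmorphism S -> T}) w x :
  divides w x -> divides (f w) (f x).
Proof. by move=> [a ->]; exists (f a); rewrite rmorphM. Qed.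

(** The fraction y/w is almost integral. *)
Definition almost_integral w y : Prop :=
  exists2 c, c != 0 & forall N, divides (w ^+ N) (c * y ^+ N).

Hypothesis domS : domain S.

(** By the binomial formula, the product of two common denominators is one for
    the powers of the sum. *)
Lemma almost_integralD w x y :
  almost_integral w x -> almost_integral w y -> almost_integral w (x + y).
Proof.
move=> [c c0 cx] [d d0 dy]; exists (c * d); first exact: domain_mulf_neq0.
move=> N; rewrite exprDn mulr_sumr; apply: divides_sum => i _.
rewrite -mulr_natr; have -> : c * d * (x ^+ (N - i) * y ^+ i * ('C(N, i))%:R)
  = (c * x ^+ (N - i)) * (d * y ^+ i) * ('C(N, i))%:R by ring.
apply: divides_mulr; rewrite -[X in w ^+ X](@subnK i) ?exprD; last by rewrite -ltnS.
exact: divides_mul.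
Qed.

Lemma almost_integralM w x y : almost_integral w y -> almost_integral w (x * y).
Proof.
move=> [c c0 cy]; exists c => // N.
by rewrite exprMn mulrCA; apply: divides_mull.
Qed.

Lemma almost_integral_id w : almost_integral w w.
Proof. by exists 1; [exact: oner_neq0|move=> N; rewrite mul1r; apply: divides_refl]. Qed.

Lemma almost_integralN w x : almost_integral w x -> almost_integral w (- x).
Proof. by rewrite -mulN1r; apply: almost_integralM. Qed.

Hypothesis cicS : completely_closed S.

Lemma cic_almost_integral w y : w != 0 -> almost_integral w y -> divides w y.
Proof. by move=> w0 [c c0 H]; apply: cicS H. Qed.

(** If b^n = q a^n, then a^n is a common denominator of the powers of b/a. *)
Lemma cic_root a b n : a != 0 -> (0 < n)%N -> divides (a ^+ n) (b ^+ n) -> divides a b.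
Proof.
move=> a0 n0 [q e]; apply: cic_almost_integral => //.
exists (a ^+ n); first exact: domain_expf_neq0.
move=> N; set k := (N %/ n)%N; set m := (N %% n)%N.
have -> : a ^+ n * b ^+ N = q ^+ k * b ^+ m * a ^+ (n * k + n).
  by rewrite (divn_eq N n) -/k -/m exprD mulnC exprM e exprMn -exprM exprD; ring.
apply/divides_mull/divides_exp_le.
by rewrite (divn_eq N n) -/k mulnC leq_add2l ltnW // ltn_pmod.
Qed.

End Divides.

(** Almost integral over B[X] implies almost integral over F[X], F the field of
    fractions of B: cancelling gcds, a nonconstant denominator w1 would have all
    its powers dividing c.  So y/w = q/e with e in B, and then the leading
    coefficient of q is divisible by e since B is completely closed; subtract it
    and repeat. *)
Lemma cic_poly_idomain (B : idomainType) : completely_closed B -> completely_closed {poly B}.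
Proof.
move=> cicB c y w c0 w0 H.
have [->|y0] := eqVneq y 0; first exact: divides0.
pose g := gcdp y w.
have g0 : g != 0 by rewrite gcdp_eq0 negb_and y0.
have [a1 a10 yE] : exists2 a, a != 0 & a *: y = (y %/ g) * g.
  have := dvdp_gcdl y w; rewrite Pdiv.Idomain.dvdp_eq => /eqP e.
  by eexists; last exact: e; rewrite Pdiv.Idomain.lc_expn_scalp_neq0.
have [a2 a20 wE] : exists2 a, a != 0 & a *: w = (w %/ g) * g.
  have := dvdp_gcdr y w; rewrite Pdiv.Idomain.dvdp_eq => /eqP e.
  by eexists; last exact: e; rewrite Pdiv.Idomain.lc_expn_scalp_neq0.
set y1 := y %/ g in yE; set w1 := w %/ g in wE.
have cop : coprimep w1 y1 by rewrite coprimep_sym coprimep_div_gcd // y0.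
have w10 : w1 != 0.
  by apply: contraNneq w0 => e; move/eqP: wE; rewrite e mul0r scale_poly_eq0 (negPf a20).
have w1c N : w1 ^+ N %| c.
  have [z zE] := H N.
  rewrite -(@Gauss_dvdpl _ _ (y1 ^+ N)); last by rewrite coprimep_expl // coprimep_expr.
  apply/Pdiv.Idomain.dvdpP; exists (a2 ^+ N, a1 ^+ N *: z) => /=; first exact: expf_neq0.
  apply: (mulIf (expf_neq0 N g0)); rewrite -!mul_polyC !rmorphXn /=.
  transitivity (a2%:P ^+ N * c * (y1 * g) ^+ N); first by rewrite exprMn; ring.
  rewrite -yE -mul_polyC exprMn.
  transitivity (a2%:P ^+ N * a1%:P ^+ N * (c * y ^+ N)); first by ring.
  rewrite zE; transitivity (a1%:P ^+ N * z * (w1 * g) ^+ N); last by rewrite exprMn; ring.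
  by rewrite -wE -mul_polyC exprMn; ring.
have /size_poly1P[k k0 w1E] : size w1 == 1.
  have := dvdp_leq c0 (w1c (size c)).
  rewrite -(ltn_predK (_ : 0 < size (w1 ^+ size c))%N) ?size_poly_gt0 ?expf_neq0 //.
  rewrite size_exp; case: (size w1) (size_poly_gt0 w1) => [|[|n]]; rewrite ?w10 //= => _.
  by rewrite mulSn ltnNge leq_addr.
have [e [q [e0 qE]]] : exists e q, e != 0 /\ e *: y = q * w.
  exists (k * a1), (a2 *: y1); split; first exact: mulf_neq0.
  rewrite -scalerA yE -mul_polyC -w1E; transitivity (y1 * (w1 * g)); first by ring.
  by rewrite -wE -!mul_polyC; ring.
have domP := @idomain_domain {poly B}.
have qai : almost_integral e%:P q.
  exists c => // N; have [z zE] := H N; exists z.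
  apply: (mulIf (expf_neq0 N w0)).
  by rewrite -mulrA -exprMn -qE -mul_polyC exprMn mulrCA zE; ring.
suff [q' q'E] : divides e%:P q.
  exists q'; apply: (@mulfI _ e%:P); rewrite ?polyC_eq0 // mul_polyC qE q'E; ring.
elim: (size q) {-2}q (leqnn (size q)) qai => {qE c H c0 w1c q} [|n IH] q sq qai.
  by have /eqP-> : q == 0; [rewrite -size_poly_leq0|exact: divides0].
have [->|q0] := eqVneq q 0; first exact: divides0.
have [b bE] : divides e (lead_coef q).
  have [c c0 H] := qai.
  apply: (cicB (lead_coef c)); rewrite ?lead_coef_eq0 // => N.
  have [z zE] := H N; exists (lead_coef z).
  move/(congr1 lead_coef): zE.
  by rewrite !lead_coefM -!rmorphXn /= lead_coefC !lead_coef_exp.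
have dE : divides e%:P (lead_coef q *: 'X^((size q).-1)).
  by exists (b *: 'X^((size q).-1)); rewrite bE -!mul_polyC rmorphM /=; ring.
rewrite -(subrK (lead_coef q *: 'X^((size q).-1)) q); apply: dividesD => //.
apply: IH.
  rewrite -ltnS; apply: leq_trans sq.
  rewrite -{2}[size q]prednK ?size_poly_gt0 // ltnS; apply/leq_sizeP => i lei.
  rewrite coefB coefZ coefXn; case: eqP => [->|/eqP ne].
    by rewrite mulr1 subrr.
  rewrite mulr0 subr0 nth_default // -[size q]prednK ?size_poly_gt0 //.
  by rewrite ltn_neqAle eq_sym ne.
apply: almost_integralD => //; apply: almost_integralN => //.
by have [d ->] := dE; apply/almost_integralM/almost_integral_id.
Qed.

Lemma domain_poly (S : comNzRingType) : domain S -> domain {poly S}.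
Proof. by move: S; apply: domainW => B; apply: idomain_domain. Qed.

Lemma cic_poly (S : comNzRingType) : domain S -> completely_closed S -> completely_closed {poly S}.
Proof. by move: S; apply: domainW => B; apply: cic_poly_idomain. Qed.

(** * Quotients *)
Lemma rmorph_factor (A C X : comNzRingType) (pi : {rmorphism A -> C}) (f : {rmorphism A -> X}) :
  (forall x, exists a, pi a = x) -> (forall a, pi a = 0 -> f a = 0) ->
  exists g : {rmorphism C -> X}, forall a, g (pi a) = f a.
Proof.
move=> surj ker.
have [s sK] := choice surj.
have gE a : f (s (pi a)) = f a.
  by apply/eqP; rewrite -subr_eq0 -rmorphB ker ?rmorphB /= ?sK ?subrr.
pose g x := f (s x).
have gB : zmod_morphism g.
  by move=> x y; rewrite /g -(sK x) -(sK y) -rmorphB !gE rmorphB.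
have gM : monoid_morphism g.
  split; first by rewrite /g -(rmorph1 pi) gE rmorph1.
  by move=> x y; rewrite /g -(sK x) -(sK y) -rmorphM !gE rmorphM.
pose gA := GRing.isZmodMorphism.Build C X g gB.
pose gM' := GRing.isMonoidMorphism.Build C X g gM.
pose gR : {rmorphism C -> X} := HB.pack g gA gM'.
by exists gR => a; rewrite /= /g gE.
Qed.

(** Quotients enter only through a surjection with known kernel; by
    [rmorph_factor] this determines all maps out of them. *)
Lemma principal_quotient (A : comNzRingType) (g : A) : ~ divides g 1 ->
  exists (C : comNzRingType) (pi : {rmorphism A -> C}),
    (forall x, exists a, pi a = x) /\ (forall a, pi a = 0 <-> divides g a).
Proof.
move=> ng1.
have cl : idealr_closed (ideal_span (fun _ : 'I_1 => g)).
  apply: ideal_span_closed; apply/negP => /asboolP[c]; rewrite big_ord1 => e.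
  by apply: ng1; exists (c ord0).
pose I : idealr A := HB.pack (ideal_span (fun _ : 'I_1 => g)) (isIdealr.Build A _ cl).
exists {ideal_quot I}, (\pi_({ideal_quot I}))%qT; split=> [x|a].
  by exists (repr x); exact: reprK.
split.
  move=> e; have : a - 0 \in I by rewrite Quotient.idealrBE e rmorph0.
  by rewrite subr0 => /asboolP[c ->]; rewrite big_ord1; exists (c ord0).
move=> [q ->]; rewrite -[RHS](rmorph0 (\pi_({ideal_quot I}))%qT).
apply/eqP; rewrite -Quotient.idealrBE subr0.
by apply/asboolP; exists (fun=> q); rewrite big_ord1.
Qed.

(** * Pure extensions B[z]/(z^M - p) *)

Lemma monic_char_poly (F : comNzRingType) (d : {poly F}) k :
  d \is monic -> size d = k.+2 -> exists A : 'M[F]_k.+1, char_poly A = d.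
Proof.
move=> /companionmxK; move: (companionmx d) => /= + + sd.
by rewrite sd /= => A; exists A.
Qed.

(** Multiplication by X on F[X]/(d) has M-th power a, so its determinant b
    satisfies b^M = det(a) = a^deg(d). *)
Lemma pure_factor_power (F : fieldType) (d : {poly F}) (a : F) (M k : nat) :
  size d = k.+2 -> d %| 'X^M - a%:P -> exists b, b ^+ M = a ^+ k.+1.
Proof.
move=> sd dvd.
have d0 : d != 0 by rewrite -size_poly_gt0 sd.
have [||A Ad] := @monic_char_poly _ ((lead_coef d)^-1 *: d) k.
- by rewrite monicE lead_coefZ mulVf // lead_coef_eq0.
- by rewrite size_scale // invr_eq0 lead_coef_eq0.
have : horner_mx A ('X^M - a%:P) = 0.
  have /dvdpP[q ->] : char_poly A %| 'X^M - a%:P.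
    by rewrite Ad dvdpZl // invr_eq0 lead_coef_eq0.
  by rewrite rmorphM /= Cayley_Hamilton mulr0.
rewrite rmorphB rmorphXn /= horner_mx_X horner_mx_C => /eqP; rewrite subr_eq0 => /eqP AM.
exists (\det A); have <- := det_scalar k.+1 a; rewrite -AM.
by elim: (M) => [|m IH]; rewrite ?expr0 ?det1 // !exprS IH detM.
Qed.

Definition radical_elt (S : comNzRingType) (q : S) : Prop :=
  forall x n, divides q (x ^+ n) -> divides q x.

Definition regular_mod (S : comNzRingType) (q p : S) : Prop :=
  forall x, divides q (p * x) -> divides q x.

Local Notation tofrac := (@FracField.tofrac _).

Lemma fractionP (B : idomainType) (b : {fraction B}) :
  exists n e : B, e != 0 /\ b = tofrac n / tofrac e.
Proof.
elim/quotW: b => y; exists (frac y).1, (frac y).2; split; first exact: denom_ratioP.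
apply/(canRL (mulfK _)); first by rewrite tofrac_eq0 denom_ratioP.
unlock FracField.tofrac; rewrite -[LHS]FracField.pi_mul.
apply/eqP; rewrite piE /FracField.equivf /FracField.mulf /=.
by rewrite !numden_Ratio ?mulf_neq0 ?oner_neq0 ?denom_ratioP // !mulr1 mulrC.
Qed.

(** A common factor of x and X^M - p has degree 0 < k < M and yields an element b
    of the fraction field with b^M = p^k ([pure_factor_power]).  Then b is in B by
    closedness and divisible by p since pB is radical, so p^M divides p^k, and p
    is a unit. *)
Lemma coprime_pure (B : idomainType) (p : B) (M : nat) :
  completely_closed B -> (0 < M)%N -> p != 0 -> ~ divides p 1 -> radical_elt p ->
  forall x : {poly B}, x != 0 -> (size x <= M)%N -> coprimep x ('X^M - p%:P).
Proof.
move=> cicB M0 p0 pnu prad x x0 sx; rewrite coprimep_def.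
set d := gcdp _ _.
have d0 : d != 0 by rewrite gcdp_eq0 negb_and x0.
have sd : (size d <= M)%N by apply: leq_trans sx; apply/dvdp_leq/dvdp_gcdl.
case Ed : (size d) sd => [|[//|k]] sd.
  by move/eqP: Ed; rewrite size_poly_eq0 (negPf d0).
exfalso.
have inj : injective (@FracField.tofrac B) by move=> u v /eqP; rewrite tofrac_eq => /eqP.
have [[c u] /= c0 cE] := Pdiv.Idomain.dvdpP _ _ (dvdp_gcdr x ('X^M - p%:P)).
have [b bM] : exists b : {fraction B}, b ^+ M = (tofrac p) ^+ k.+1.
  apply: (@pure_factor_power _ (map_poly tofrac d)).
    by rewrite size_map_inj_poly // rmorph0.
  have -> : 'X^M - ((tofrac p))%:P = map_poly tofrac ('X^M - p%:P).
    by rewrite rmorphB /= map_polyXn map_polyC.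
  rewrite -(@dvdpZr _ (tofrac c)) ?tofrac_eq0 // -map_polyZ cE rmorphM.
  exact: dvdp_mull.
have [n [e [e0 bE]]] := fractionP b.
have nE : n ^+ M = p ^+ k.+1 * e ^+ M.
  apply: inj; rewrite rmorphM !rmorphXn -bM bE expr_div_n divfK //.
  by rewrite expf_neq0 // tofrac_eq0.
have domB := @idomain_domain B.
have [f fE] : divides e n.
  by apply: (cic_root domB cicB e0 M0); exists (p ^+ k.+1).
have fM : f ^+ M = p ^+ k.+1.
  by apply: (mulIf (expf_neq0 M e0)); rewrite -exprMn -fE.
have [h hE] : divides p f.
  by apply: (prad f M); rewrite fM exprS; exists (p ^+ k); rewrite mulrC.
apply: pnu; exists (h ^+ M * p ^+ (M - k.+2)).
apply: (mulIf (expf_neq0 k.+1 p0)); rewrite mul1r -{1}fM hE exprMn.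
by rewrite -!mulrA -exprS -exprD subnK.
Qed.

Lemma pure_bezout (B : comNzRingType) (p : B) (M : nat) :
  domain B -> completely_closed B -> (0 < M)%N -> p != 0 -> ~ divides p 1 -> radical_elt p ->
  forall x : {poly B}, x != 0 -> (size x <= M)%N ->
  exists (u v : {poly B}) (c : B), c != 0 /\ u * x + v * ('X^M - p%:P) = c%:P.
Proof.
move=> domB; move: B domB p; apply: domainW => B p cicB M0 p0 pnu prad x x0 sx.
have /Pdiv.Idomain.Bezout_coprimepP[[u v]] := coprime_pure cicB M0 p0 pnu prad x0 sx.
by rewrite -size_poly_eq1 => /size_poly1P[c c0 e]; exists u, v, c.
Qed.

(** In this section C = B[z]/(z^M - p), with z the image of X. *)
Section PureExtension.

Variables (B C : comNzRingType) (M : nat) (p : B).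
Variables (pi : {rmorphism {poly B} -> C}).
Hypothesis M_gt0 : (0 < M)%N.
Hypothesis pi_surj : forall x, exists a, pi a = x.
Hypothesis pi_ker : forall a, pi a = 0 <-> divides ('X^M - p%:P) a.

Definition pure_embed : B -> C := pi \o polyC.
HB.instance Definition _ := GRing.RMorphism.copy pure_embed (pi \o polyC).
Local Notation iota := pure_embed.
Local Notation z := (pi 'X).
Local Notation g := ('X^M - p%:P).

Lemma pure_monic : g \is monic.
Proof. exact: monicXnsubC. Qed.

Lemma pure_size : size g = M.+1.
Proof. exact: size_XnsubC. Qed.

(** Euclidean division by the monic polynomial z^M - p: C is free over B on
    1, z, ..., z^(M-1). *)
Lemma pure_rep x : exists2 r : {poly B}, (size r <= M)%N & pi r = x.
Proof.
have [a <-] := pi_surj x; exists (Pdiv.CommonRing.rmodp a g).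
  by rewrite -ltnS -pure_size Pdiv.CommonRing.ltn_rmodpN0 // monic_neq0 // pure_monic.
rewrite [in RHS](Pdiv.RingMonic.rdivp_eq pure_monic a) rmorphD.
have -> : pi (Pdiv.CommonRing.rdivp a g * g) = 0 by apply/pi_ker; eexists.
by rewrite add0r.
Qed.

Lemma pure_inj (r : {poly B}) : (size r <= M)%N -> pi r = 0 -> r = 0.
Proof.
move=> sr /pi_ker[q e]; apply/eqP; case: (eqVneq q 0) => [q0|q0].
  by rewrite e q0 mul0r.
move: sr; rewrite e size_Mmonic ?pure_monic // pure_size addnS /= => sr.
by move: sr; rewrite -[leqRHS]add0n leq_add2r leqn0 size_poly_eq0 (negPf q0).
Qed.

Lemma pure_injB (r s : {poly B}) : (size r <= M)%N -> (size s <= M)%N -> pi r = pi s -> r = s.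
Proof.
move=> sr ss e; apply/eqP; rewrite -subr_eq0; apply/eqP/pure_inj.
  by rewrite (leq_trans (size_polyD _ _)) // size_polyN geq_max sr.
by rewrite rmorphB e subrr.
Qed.

Lemma pure_embed_inj : injective iota.
Proof.
move=> a b /pure_injB e; apply: polyC_inj; apply: e;
by rewrite size_polyC; case: eqP.
Qed.

Lemma pure_root : z ^+ M = iota p.
Proof.
apply/eqP; rewrite -subr_eq0 -rmorphXn -rmorphB; apply/eqP/pi_ker.
exact: divides_refl.
Qed.

Lemma pure_expand (r : {poly B}) : (size r <= M)%N -> pi r = \sum_(i < M) iota r`_i * z ^+ i.
Proof.
move=> sr; rewrite -{1}(coefK r) (poly_def (size r)) rmorph_sum /=.
rewrite (big_ord_widen M (fun i => pi (r`_i *: 'X^i)) sr) /= big_mkcond.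
apply: eq_bigr => i _; case: ltnP => h.
  by rewrite -mul_polyC rmorphM rmorphXn.
by rewrite nth_default // rmorph0 mul0r.
Qed.

Lemma pure_divides b (r : {poly B}) : (size r <= M)%N ->
  divides (iota b) (pi r) <-> forall i, divides b r`_i.
Proof.
move=> sr; split=> [[y e] i|H].
  have [s ss sE] := pure_rep y.
  have -> : r = b *: s.
    apply: pure_injB => //; first exact: leq_trans (size_scale_leq _ _) ss.
    by rewrite e -sE -mul_polyC rmorphM mulrC.
  by exists s`_i; rewrite coefZ mulrC.
rewrite pure_expand //; apply: divides_sum => i _; apply: divides_mulr.
exact: divides_rmorph.
Qed.

Lemma pure_divides_embed b a : divides (iota b) (iota a) -> divides b a.
Proof.
have sa : (size a%:P <= M)%N by rewrite size_polyC; case: eqP.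
by move=> /(pure_divides _ sa)/(_ 0); rewrite coefC.
Qed.

Variables (K : fieldType) (kappa : {rmorphism K -> B}) (zeta : K).
Hypothesis zetaP : M.-primitive_root zeta.
Hypothesis M_neq0 : M%:R != 0 :> K.

Lemma sum_root_of_unity (i j : 'I_M) :
  \sum_(k < M) zeta ^+ (k * (M - i + j)) = M%:R *+ (i == j).
Proof.
set t := (M - i + j)%N; have dvdt : (M %| t)%N = (i == j).
  rewrite /t; apply/idP/eqP => [|->]; last by rewrite subnK ?dvdnn // ltnW.
  move=> /dvdnP[q] e; apply/ord_inj; have := ltn_ord i; have := ltn_ord j.
  by case: q e => [|[|q]]; rewrite ?mulSn; lia.
have -> : \sum_(k < M) zeta ^+ (k * t) = \sum_(k < M) (zeta ^+ t) ^+ k.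
  by apply: eq_bigr => k _; rewrite mulnC exprM.
rewrite -dvdt (prim_order_dvd zetaP).
have [->|nt] := eqVneq (zeta ^+ t) 1.
  by rewrite (eq_bigr (fun=> 1)) => [|k _]; rewrite ?expr1n // sumr_const card_ord.
apply: (@mulfI _ (zeta ^+ t - 1)); first by rewrite subr_eq0.
by rewrite -subrX1 -exprM mulnC exprM (prim_expr_order zetaP) expr1n subrr mulr0.
Qed.

Lemma pure_rotation : exists sigma : {rmorphism C -> C},
  (forall b, sigma (iota b) = iota b) /\ sigma z = iota (kappa zeta) * z.
Proof.
pose q : {poly B} := kappa zeta *: 'X.
have [a|sigma sE] := @rmorph_factor _ _ _ pi (pi \o comp_poly q) pi_surj.
  move=> /pi_ker[u ->]; rewrite /= comp_polyM comp_polyB comp_polyC comp_Xn_poly.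
  rewrite exprZn -rmorphXn (prim_expr_order zetaP) rmorph1 scale1r.
  by apply/pi_ker; exists (u \Po q).
exists sigma; split=> [b|]; first by rewrite /iota /= sE /= comp_polyC.
by rewrite sE /= comp_polyX /q -mul_polyC rmorphM.
Qed.

(** The i-th component of x is the average of zeta^(-ki) sigma^k(x) over k < M;
    an ideal stable under the rotation thus contains the components of its
    elements. *)
Lemma pure_component (J : C -> Prop) (sigma : {rmorphism C -> C}) :
  (forall b, sigma (iota b) = iota b) -> sigma z = iota (kappa zeta) * z ->
  J 0 -> (forall x y, J x -> J y -> J (x + y)) -> (forall x y, J y -> J (x * y)) ->
  (forall x, J x -> J (sigma x)) ->
  forall r : {poly B}, (size r <= M)%N -> J (pi r) -> forall i : 'I_M, J (iota r`_i * z ^+ i).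
Proof.
move=> sb sz J0 JD JM Js r sr Jr i.
have Jk k : J (iter k sigma (pi r)) by elim: k => //= k; apply: Js.
set e := iota (kappa zeta) in sz.
have kE k : iter k sigma (pi r) = \sum_(j < M) e ^+ (k * j) * (iota r`_j * z ^+ j).
  elim: k => [|k IH] /=.
    by rewrite pure_expand //; apply: eq_bigr => j _; rewrite mul0n mul1r.
  rewrite IH rmorph_sum; apply: eq_bigr => j _.
  rewrite !rmorphM !rmorphXn !sb sz exprMn mulSn exprD; ring.
(* zeta^(k(M - i)) = zeta^(-ki), without negative exponents. *)
have : J (iota (kappa M%:R^-1) *
   \sum_(k < M) e ^+ (k * (M - i)) * iter k sigma (pi r)).
  by apply: (JM); elim/big_rec: _ => // k x _ Jx; apply: (JD) => //; apply/JM/Jk.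
congr J; transitivity (iota (kappa M%:R^-1) *
   \sum_(j < M) (\sum_(k < M) e ^+ (k * (M - i + j))) * (iota r`_j * z ^+ j)).
  congr (_ * _); under eq_bigr do rewrite kE mulr_sumr.
  rewrite exchange_big /=; apply: eq_bigr => j _; rewrite mulr_suml.
  by apply: eq_bigr => k _; rewrite mulnDr exprD mulrA.
have sE (j : 'I_M) : \sum_(k < M) e ^+ (k * (M - i + j)) = iota (kappa (M%:R *+ (i == j))).
  rewrite -sum_root_of_unity !rmorph_sum; apply: eq_bigr => k _.
  by rewrite !rmorphXn.
under eq_bigr do rewrite sE; rewrite (bigD1 i) // big1 => [|j ji].
  rewrite [X in _ * X]addr0 eqxx mulr1n mulrA.
  have -> : iota (kappa M%:R^-1) * iota (kappa M%:R) = 1.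
    by rewrite -(rmorphM iota) -(rmorphM kappa) mulVf // !rmorph1.
  by rewrite mul1r.
by rewrite eq_sym (negPf ji) !rmorph0 mul0r.
Qed.

(** The radical of qC is stable under the rotation, so it suffices to treat b z^i:
    from (b z^i)^m in qC follows b^(mM) p^(im) in qB, where p can be cancelled. *)
Lemma pure_radical q : radical_elt q -> regular_mod q p -> radical_elt (iota q).
Proof.
move=> qrad qreg x n qx.
have [sigma [sb sz]] := pure_rotation.
have [r sr xE] := pure_rep x.
pose J y := exists n, divides (iota q) (y ^+ n).
have Jr : J (pi r) by exists n; rewrite xE.
have JE := @pure_component J _ sb sz _ _ _ _ r sr Jr.
rewrite -xE; apply/pure_divides => // i.
have [iM|] := ltnP i M; last by move=> h; rewrite nth_default ?(leq_trans sr) //; apply: divides0.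
have [||||m] := JE _ _ _ _ (Ordinal iM).
- by exists 1; apply: divides0.
- move=> u v [a ua] [b vb]; exists (a + b)%N.
  rewrite exprDn; apply: divides_sum => j _; rewrite -mulr_natl; apply: divides_mull.
  have [le|lt] := leqP b j.
    by apply: divides_mull; rewrite -(subnK le) exprD; apply: divides_mull.
  apply: divides_mulr; rewrite -(@subnK a (a + b - j)%N); last lia.
  by rewrite exprD; apply: divides_mull.
- by move=> u v [a ua]; exists a; rewrite exprMn; apply: divides_mull.
- by move=> u [a ua]; exists a; rewrite -rmorphXn -sb; apply: divides_rmorph.
rewrite /= exprMn -exprM => H.
apply: (qrad _ (m * M)%N).
have : divides (iota q) (iota (p ^+ (i * m) * r`_i ^+ (m * M))).
  have -> : iota (p ^+ (i * m) * r`_i ^+ (m * M)) = (iota r`_i ^+ m * z ^+ (i * m)) ^+ M.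
    by rewrite rmorphM !rmorphXn /= -pure_root exprMn -!exprM mulrC [(M * _)%N]mulnC.
  by rewrite -(prednK M_gt0) exprS; apply: divides_mulr.
move=> /pure_divides_embed; elim: (i * m)%N => [|k IH]; first by rewrite mul1r.
by rewrite exprS -mulrA => /qreg.
Qed.

Lemma pure_regular q q' : regular_mod q q' -> regular_mod (iota q) (iota q').
Proof.
move=> H x; have [r sr <-] := pure_rep x.
have -> : iota q' * pi r = pi (q' *: r) by rewrite -mul_polyC rmorphM.
move=> /pure_divides-/(_ (leq_trans (size_scale_leq _ _) sr)) d.
by apply/pure_divides => // i; apply: H; rewrite -coefZ.
Qed.

Lemma pure_nonunit q : ~ divides q 1 -> ~ divides (iota q) 1.
Proof. by move=> H; rewrite -(rmorph1 iota) => /pure_divides_embed. Qed.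

Hypothesis domB : domain B.
Hypothesis cicB : completely_closed B.
Hypothesis p_neq0 : p != 0.
Hypothesis p_nonunit : ~ divides p 1.
Hypothesis p_radical : radical_elt p.

(** A Bezout relation between x and z^M - p plays the role of a norm: every
    nonzero element divides a nonzero element of B. *)
Lemma pure_norm x : x != 0 -> exists y c, c != 0 /\ y * x = iota c.
Proof.
move=> x0; have [r sr xE] := pure_rep x.
have r0 : r != 0 by apply: contraNneq x0 => r0; rewrite -xE r0 rmorph0.
have [u [v [c [c0 e]]]] := pure_bezout domB cicB M_gt0 p_neq0 p_nonunit p_radical r0 sr.
exists (pi u), c; split=> //; rewrite -xE /iota /= -e rmorphD !rmorphM.
have -> : pi g = 0 by apply/pi_ker; apply: divides_refl.
by rewrite mulr0 addr0.
Qed.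

Lemma pure_embed_regular c x : c != 0 -> iota c * x = 0 -> x = 0.
Proof.
move=> c0; have [r sr <-] := pure_rep x.
have -> : iota c * pi r = pi (c *: r) by rewrite -mul_polyC rmorphM.
move=> /pure_inj-/(_ (leq_trans (size_scale_leq _ _) sr)) /polyP e.
have -> : r = 0; last by rewrite rmorph0.
apply/polyP => i; apply: (domain_mulfI domB c0).
by have := e i; rewrite coefZ !coef0 mulr0.
Qed.

Lemma pure_domain : domain C.
Proof.
move=> x y xy; have [//|x0] := eqVneq x 0 => /=.
have [x' [c [c0 e]]] := pure_norm x0.
by apply/eqP/(pure_embed_regular c0); rewrite -e -mulrA xy mulr0.
Qed.

Lemma pure_almost_integral n x : almost_integral (iota n) x ->
  exists2 k, k != 0 & forall N, divides (iota n ^+ N) (iota k * x ^+ N).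
Proof.
move=> [c c0 H]; have [c' [k [k0 ck]]] := pure_norm c0.
by exists k => // N; rewrite -ck -mulrA; apply: divides_mull.
Qed.

(** With a norm one may take the denominator n in B.  An almost integral element
    then has almost integral components b z^i / n, for 0 <= i < M.  Multiplying by
    z^(M-i) gives bp = ne with e in B, and raising to the M-th power gives
    n^M | b^M p^i, hence e^M = f p^(M-i) is in pB.  So p divides e, and n divides
    b. *)
Lemma pure_cic : completely_closed C.
Proof.
move=> c y w c0 w0 H.
have domC := pure_domain.
have [w' [n [n0 wn]]] := pure_norm w0.
suff : divides (iota n) (w' * y).
  move=> [q qE]; exists q; apply: (@domain_mulfI _ domC (iota n)).
    by apply: contra_neq n0 => e; apply: pure_embed_inj; rewrite e rmorph0.
  by rewrite -{1}wn [_ * w]mulrC -mulrA qE; ring.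
have ai : almost_integral (iota n) (w' * y).
  exists c => // N; have [q qE] := H N; exists q.
  by rewrite -wn !exprMn; ring: qE.
have [sigma [sb sz]] := pure_rotation.
have [r sr yE] := pure_rep (w' * y).
rewrite -yE in ai *; apply/pure_divides => // i.
have [iM|] := ltnP i M; last first.
  by move=> h; rewrite nth_default ?(leq_trans sr) //; apply: divides0.
have /pure_almost_integral[m m0 Hm] : almost_integral (iota n) (iota r`_i * z ^+ i).
  apply: (@pure_component _ sigma sb sz _ _ _ _ r sr ai (Ordinal iM)) => [|u v|u v|u].
  - by rewrite -(mul0r (iota n)); apply/almost_integralM/almost_integral_id.
  - exact: almost_integralD.
  - exact: almost_integralM.
  - move=> /pure_almost_integral[a a0 ua]; exists (iota a) => [|N].
      by apply: contra_neq a0 => e; apply: pure_embed_inj; rewrite e rmorph0.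
    by rewrite -rmorphXn -[iota a]sb -[iota n]sb -rmorphXn -rmorphM; apply: divides_rmorph.
set b := r`_i in Hm *.
have nbp : divides n (b * p).
  apply: (cicB m0 n0) => N; apply: pure_divides_embed.
  rewrite rmorphXn rmorphM rmorphXn rmorphM /= -pure_root.
  rewrite -[X in z ^+ X](subnK (ltnW iM)) addnC exprD mulrA exprMn mulrA.
  by apply: divides_mulr; apply: Hm.
have [e eE] := nbp.
have nM : divides (n ^+ M) (b ^+ M * p ^+ i).
  apply: (cicB m0 (domain_expf_neq0 domB M n0)) => N; apply: pure_divides_embed.
  rewrite -exprM rmorphXn rmorphM rmorphXn rmorphM !rmorphXn /= -pure_root.
  have -> : (iota b ^+ M * (z ^+ M) ^+ i) ^+ N = (iota b * z ^+ i) ^+ (M * N).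
    by rewrite [RHS]exprM; congr (_ ^+ N); rewrite exprMn -!exprM mulnC.
  exact: Hm.
have [f fE] := nM.
have [e' e'E] : divides p e.
  apply: (p_radical (n := M)); exists (f * p ^+ (M - i).-1).
  apply: (domain_mulfI domB (domain_expf_neq0 domB M n0)).
  rewrite mulrC -exprMn -eE exprMn -mulrA -exprSr prednK ?subn_gt0 //.
  by rewrite mulrA [n ^+ M * f]mulrC -fE -mulrA -exprD subnKC // ltnW.
exists e'; apply: (domain_mulfI domB p_neq0).
by rewrite mulrC eE e'E; ring.
Qed.

Lemma pure_universal (X : comNzRingType) (f : {rmorphism B -> X}) (x : X) :
  x ^+ M = f p ->
  exists h : {rmorphism C -> X}, (forall b, h (iota b) = f b) /\ h z = x.
Proof.
move=> xM.
have cfx : commr_rmorph f x by move=> b; apply: mulrC.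
have [a|h hE] := @rmorph_factor _ _ _ pi (horner_morph cfx) pi_surj.
  move=> /pi_ker[u ->]; rewrite rmorphM /= rmorphB /= rmorphXn /= horner_morphX.
  by rewrite horner_morphC xM subrr mulr0.
exists h; split=> [b|]; first by rewrite /iota /= hE /= horner_morphC.
by rewrite hE /= horner_morphX.
Qed.

End PureExtension.

Lemma pure_quotient (B : comNzRingType) (p : B) (M : nat) : (0 < M)%N ->
  exists (C : comNzRingType) (pi : {rmorphism {poly B} -> C}),
    (forall x, exists a, pi a = x) /\ (forall a, pi a = 0 <-> divides ('X^M - p%:P) a).
Proof.
move=> M0; apply: principal_quotient => -[q /(congr1 (fun a : {poly B} => size a))].
case: (eqVneq q 0) => [->|q0]; first by rewrite mul0r size_poly0 size_poly1.
rewrite size_Mmonic ?monicXnsubC // size_XnsubC // size_poly1 addnS /= => e.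
have : (0 < size q)%N by rewrite size_poly_gt0.
by move: M0 e; case: M => // M _; rewrite addnS; case: (size q).
Qed.

(** The elements p_i are adjoined one after the other.  That they are radical and
    pairwise regular modulo each other survives each step, and this is what makes
    the next step possible. *)
Lemma adjoin_roots (K : fieldType) (M : nat) (zeta : K) : (0 < M)%N ->
  M.-primitive_root zeta -> M%:R != 0 :> K ->
  forall (m : nat) (B : comNzRingType) (kappa : {rmorphism K -> B}) (p : nat -> B),
  domain B -> completely_closed B ->
  (forall i, (i < m)%N -> [/\ p i != 0, ~ divides (p i) 1 & radical_elt (p i)]) ->
  (forall i j, (i < m)%N -> (j < m)%N -> i != j -> regular_mod (p i) (p j)) ->
  exists (C : comNzRingType) (iota : {rmorphism B -> C}) (z : nat -> C),
    [/\ domain C, completely_closed C, injective iota, forall i, (i < m)%N -> z i ^+ M = iota (p i)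
      & forall (X : comNzRingType) (f : {rmorphism B -> X}) (x : nat -> X),
        (forall i, (i < m)%N -> x i ^+ M = f (p i)) ->
        exists h : {rmorphism C -> X},
          (forall b, h (iota b) = f b) /\ forall i, (i < m)%N -> h (z i) = x i].
Proof.
move=> M0 zetaP MK; elim=> [|m IH] B kappa p domB cicB pgood preg.
  exists B, idfun, p; split=> // X f x _; exists f; split=> //.
have [C [pi [surj ker]]] := pure_quotient (p m) M0.
have [pm0 pmu pmr] := pgood m (ltnSn m).
pose iota : {rmorphism B -> C} := @pure_embed B C pi.
have inj : injective iota := pure_embed_inj M0 ker.
have domC := pure_domain M0 surj ker domB cicB pm0 pmu pmr.
have cicC := pure_cic M0 surj ker kappa zetaP MK domB cicB pm0 pmu pmr.
have [||D [i2 [z [domD cicD inj2 zE univ]]]] :=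
  IH C (iota \o kappa) (iota \o p) domC cicC.
- move=> i im; have [p0 pu pr] := pgood i (leqW im); split=> /=.
  + by apply: contra_neq p0 => e; apply: inj; apply: etrans e (esym (rmorph0 iota)).
  + exact: (pure_nonunit M0 surj ker pu).
  + apply: (pure_radical M0 surj ker kappa zetaP MK pr); apply: preg.
    * exact: leqW.
    * exact: ltnSn.
    * by rewrite neq_ltn im.
- by move=> i j im jm ij; apply: (pure_regular M0 surj ker); apply: preg; rewrite ?leqW.
exists D, (i2 \o iota), (fun i => if i == m then i2 (pi 'X) else z i).
split=> //; first by apply: inj_comp.
  move=> i; rewrite ltnS leq_eqVlt; case: eqP => [-> _|_ /= im].
    by rewrite -rmorphXn (pure_root ker).
  exact: zE.
move=> X f x xE.
have [g [gE gz]] := pure_universal surj ker (xE m (ltnSn m)).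
have [|h [hE hz]] := univ X g x.
  by move=> i im; rewrite xE ?leqW //= gE.
exists h; split=> [b|i] /=; first by rewrite hE gE.
rewrite ltnS leq_eqVlt; case: eqP => [-> _|_ /= im]; last exact: hz.
by rewrite hE gz.
Qed.

(** * Splitting an element into a product of new elements *)

Lemma divides_polyC (B : comNzRingType) (c : B) (h : {poly B}) :
  divides c%:P h <-> forall i, divides c h`_i.
Proof.
split=> [[q ->] i|H]; first by exists q`_i; rewrite coefMC.
rewrite -(coefK h) poly_def; apply: divides_sum => i _.
by have [a ->] := H i; exists (a *: 'X^i); rewrite -!mul_polyC rmorphM /=; ring.
Qed.

Lemma dividesX (B : comNzRingType) (a : {poly B}) : a.[0] = 0 -> divides 'X a.
Proof. by move=> /eqP/factor_theorem[q ->]; exists q; rewrite subr0. Qed.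

(** In this section v = ev 'X, and C lies between B[v] and B[v, 1/v]. *)
Section Localization.

Variables (B C : comNzRingType) (ev : {rmorphism {poly B} -> C}).
Hypothesis domB : domain B.
Hypothesis cicB : completely_closed B.
Hypothesis domC : domain C.
Hypothesis ev_inj : injective ev.
Local Notation v := (ev 'X).
Hypothesis ev_denom : forall x, exists n a, v ^+ n * x = ev a.

Lemma divides_saturated (w t s : {poly B}) e :
  w.[0] != 0 -> s * w = t * 'X^e -> divides w t.
Proof.
move=> w0; elim: e t s => [|e IH] t s; first by rewrite mulr1 => <-; exists s.
move=> E; have /dividesX[s' s'E] : s.[0] = 0.
  apply: (domain_mulfI domB w0); rewrite mulr0 mulrC -hornerM E.
  by rewrite hornerM hornerXn expr0n mulr0.
apply: (IH t s'); apply: (@domain_mulfI _ (domain_poly domB) 'X).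
  by rewrite polyX_eq0.
by move: E; rewrite s'E exprS => E; transitivity (s' * 'X * w); [ring|rewrite E; ring].
Qed.

(** Closedness of C up to powers of v.  Clear the denominators, which are powers
    of v; a power of v in w is harmless, and the part of w prime to v divides y
    already in B[v], by [cic_poly]. *)
Lemma cic_away c y w : c != 0 -> w != 0 -> (forall N, divides (w ^+ N) (c * y ^+ N)) ->
  exists k, divides w (v ^+ k * y).
Proof.
move=> c0 w0 H.
have X0 : 'X != 0 :> {poly B} by rewrite polyX_eq0.
have v0 : v != 0 by apply: contra_neq X0 => e; apply: ev_inj; rewrite e rmorph0.
have [n [w1 wE]] := ev_denom w; have [n' [y1 yE]] := ev_denom y.
have [m [c1 cE]] := ev_denom c.
have nz (x : C) k a : x != 0 -> v ^+ k * x = ev a -> a != 0.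
  move=> x0 e; apply: contraTneq (domain_mulf_neq0 domC (domain_expf_neq0 domC k v0) x0).
  by move=> a0; rewrite e a0 rmorph0 eqxx.
have domP := domain_poly domB; have cicP := cic_poly domB cicB.
have [k [w2 [w20 w2E]]] : exists k w2, w2.[0] != 0 /\ w1 = 'X^k * w2.
  have : w1 != 0 by apply: nz wE.
  elim: (size w1) {-2}w1 (leqnn (size w1)) => [|s IH] a sa a0.
    by move: sa; rewrite leqn0 size_poly_eq0 (negPf a0).
  have [/dividesX[q qE]|] := eqVneq a.[0] 0; last by exists 0%N, a; rewrite mul1r.
  have q0 : q != 0 by apply: contraNneq a0 => q0; rewrite qE q0 mul0r.
  have [|//|k [w2 [w20 w2E]]] := IH q.
    by move: sa; rewrite qE size_mulX.
  by exists k.+1, w2; split=> //; rewrite qE w2E exprS; ring.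
have [q qE] : divides w2 y1.
  apply: (cicP c1); first exact: nz cE.
    by apply: contraNneq w20 => ->; rewrite horner0.
  move=> N; have [z zE] := H N; have [e [z1 z1E]] := ev_denom z.
  apply: (@divides_saturated _ _ ('X^(k * N + n' * N + m) * z1) (e + n * N)).
    by rewrite horner_exp domain_expf_neq0.
  apply: ev_inj; rewrite !rmorphM !rmorphXn /= -cE -z1E -yE.
  transitivity (v ^+ (n' * N + m) * v ^+ e * z * (ev ('X^k * w2)) ^+ N).
    by rewrite rmorphM rmorphXn /= exprMn -exprM !exprD; ring.
  rewrite -w2E -wE !exprMn -!exprM.
  transitivity (v ^+ (n' * N + m) * v ^+ e * v ^+ (n * N) * (z * w ^+ N)); first by ring.
  by rewrite -zE !exprD; ring.
exists (n' + k)%N; exists (v ^+ n * ev q).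
have -> : v ^+ (n' + k) * y = v ^+ k * (v ^+ n' * y) by rewrite exprD; ring.
rewrite yE qE rmorphM; transitivity (ev q * ev ('X^k * w2)).
  by rewrite rmorphM rmorphXn /=; ring.
by rewrite -w2E -wE; ring.
Qed.

End Localization.

(** In this section C = B[v, u]/(vu - p), where v is the variable of the
    coefficient ring B[v]. *)
Section SplitExtension.

Variables (B C : comNzRingType) (p : B).
Variable pi : {rmorphism {poly {poly B}} -> C}.
Local Notation g := ('X%:P * 'X - p%:P%:P : {poly {poly B}}).
Hypothesis pi_surj : forall x, exists a, pi a = x.
Hypothesis pi_ker : forall a, pi a = 0 <-> divides g a.
Hypothesis domB : domain B.
Hypothesis p_neq0 : p != 0.

Local Notation v := (pi 'X%:P).
Local Notation u := (pi 'X).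
Local Notation iota := (fun b : B => pi b%:P%:P).

Lemma split_mul : v * u = iota p.
Proof.
apply/eqP; rewrite -rmorphM -subr_eq0 -rmorphB; apply/eqP/pi_ker; exact: divides_refl.
Qed.

(* Reduction modulo v. *)
Local Notation red := (map_poly (horner_eval (0 : B))).

Lemma red_g : red g = (- p)%:P.
Proof.
rewrite rmorphB rmorphM /= !map_polyC map_polyX /= /horner_eval hornerX hornerC.
by rewrite mul0r sub0r polyCN.
Qed.

Lemma red_divides a : red a = 0 -> divides 'X%:P a.
Proof.
move=> /polyP e; apply/divides_polyC => i; apply: dividesX.
by have := e i; rewrite coef0 coef_map.
Qed.

(** B[v] embeds: comparing coefficients of u in a = h (vu - p) gives v h_n = p h_(n+1)
    for all n, so h = 0 by descending induction. *)
Lemma split_const_inj a : pi a%:P = 0 -> a = 0.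
Proof.
move=> /pi_ker[h e].
have X0 : 'X != 0 :> {poly B} by rewrite polyX_eq0.
have hS n : h`_n * 'X = h`_n.+1 * p%:P.
  have /eqP := congr1 (fun q : {poly {poly B}} => q`_n.+1) e.
  by rewrite coefC /= eq_sym mulrBr coefB mulrA coefMX /= !coefMC subr_eq0 => /eqP.
have h0 k n : (size h <= n + k)%N -> h`_n = 0.
  elim: k n => [|k IH] n; first by rewrite addn0; apply: nth_default.
  rewrite addnS -addSn => /IH hn; apply: (domain_mulfI (domain_poly domB) X0).
  by rewrite mulr0 mulrC hS hn mul0r.
have hz : h = 0 by apply/polyP => i; rewrite coef0 (h0 (size h)) // leq_addl.
by apply: polyC_inj; rewrite e hz mul0r.
Qed.

Lemma split_regular x : v * x = 0 -> x = 0.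
Proof.
have [a <-] := pi_surj x; rewrite -rmorphM => /pi_ker[h e].
have /red_divides[k hE] : red h = 0.
  apply/polyP => i; apply: (domain_mulfI domB p_neq0); rewrite coef0 mulr0.
  have := congr1 (fun q : {poly {poly B}} => (red q)`_i) e.
  rewrite !rmorphM /= red_g map_polyC /= /horner_eval hornerX mul0r coef0 coefMC => /esym/eqP.
  by rewrite mulrN oppr_eq0 mulrC => /eqP.
apply/pi_ker; exists k; apply: (@domain_mulfI _ (domain_poly (domain_poly domB)) 'X%:P).
  by rewrite polyC_eq0 polyX_eq0.
by rewrite e hE; ring.
Qed.

(** Modulo v the ring C becomes (B/p)[u], where u is regular. *)
Lemma split_regular_mod x : divides v (u * x) -> divides v x.
Proof.
have [a <-] := pi_surj x => -[y]; have [b <-] := pi_surj y.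
move=> /eqP; rewrite -subr_eq0 -!rmorphM -rmorphB => /eqP/pi_ker[h e].
have E : 'X * red a = - (red h * p%:P).
  have := congr1 (fun q : {poly {poly B}} => red q) e.
  rewrite rmorphB !rmorphM /= red_g map_polyX map_polyC /= /horner_eval hornerX.
  by rewrite mulr0 subr0 polyCN mulrN.
have /dividesX[k kE] : (red h).[0] = 0.
  apply: (domain_mulfI domB p_neq0); have := congr1 (fun q => q.[0]) E.
  by rewrite hornerM hornerX mul0r hornerN hornerM hornerC mulr0 => /esym/eqP;
  rewrite oppr_eq0 mulrC => /eqP.
have aE : red a = - (k * p%:P).
  apply: (@domain_mulfI _ (domain_poly domB) 'X); first by rewrite polyX_eq0.
  by rewrite E kE; ring.
pose k' : {poly {poly B}} := map_poly polyC k.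
have redk : red k' = k.
  rewrite /k' -map_poly_comp map_poly_id // => i _.
  by rewrite /= /horner_eval hornerC.
have /red_divides[q qE] : red (a - k' * g) = 0.
  by rewrite rmorphB rmorphM /= red_g redk aE polyCN mulrN subrr.
exists (pi q); rewrite -rmorphM -qE rmorphB.
have -> : pi (k' * g) = 0 by apply/pi_ker; exists k'.
by rewrite subr0.
Qed.

Lemma split_denom x : exists n a, v ^+ n * x = pi a%:P.
Proof.
have [a <-] := pi_surj x; elim/poly_ind: a => [|a c [n [b bE]]].
  by exists 0%N, 0; rewrite !rmorph0 mulr0.
exists n.+1, (b * p%:P + 'X ^+ n.+1 * c).
rewrite !rmorphD !rmorphM /= -bE !rmorphXn /= -split_mul exprS; ring.
Qed.

(** Up to powers of v, which are regular, C is the domain B[v]. *)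
Lemma split_domain : domain C.
Proof.
move=> x y xy.
have [n [a aE]] := split_denom x; have [m [b bE]] := split_denom y.
have reg k t : v ^+ k * t = 0 -> t = 0.
  by elim: k => [|k IH]; rewrite ?mul1r // exprS -mulrA => /split_regular.
have /domain_poly-/(_ a b) : domain B by [].
case/(_ _)/orP => [|/eqP a0|/eqP b0].
- apply: split_const_inj; rewrite rmorphM rmorphM -aE -bE.
  transitivity (v ^+ n * v ^+ m * (x * y)); first by ring.
  by rewrite xy mulr0.
- by rewrite (reg n x) ?eqxx // aE a0 !rmorph0.
- by rewrite (reg m y) ?eqxx ?orbT // bE b0 !rmorph0.
Qed.

Lemma split_embed_inj : injective iota.
Proof.
move=> a b /eqP; rewrite -subr_eq0 -!rmorphB => /eqP/split_const_inj/eqP.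
by rewrite polyC_eq0 subr_eq0 => /eqP.
Qed.

Lemma split_universal (X : comNzRingType) (f : {rmorphism B -> X}) (x y : X) :
  x * y = f p ->
  exists h : {rmorphism C -> X}, [/\ forall b, h (iota b) = f b, h v = x & h u = y].
Proof.
move=> xy.
have c1 : commr_rmorph f x by move=> b; apply: mulrC.
have c2 : commr_rmorph (horner_morph c1) y by move=> b; apply: mulrC.
have [a|h hE] := @rmorph_factor _ _ _ pi (horner_morph c2) pi_surj.
  move=> /pi_ker[k ->]; rewrite rmorphM rmorphB rmorphM /= horner_morphX !horner_morphC /=.
  by rewrite horner_morphX horner_morphC xy subrr mulr0.
exists h; split=> [b||].
- by rewrite hE /= horner_morphC /= horner_morphC.
- by rewrite hE /= horner_morphC /= horner_morphX.
- by rewrite hE /= horner_morphX.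
Qed.

End SplitExtension.

(** The relation vu = p is symmetric, so this carries statements about v over to
    u. *)
Lemma swap_variables (B : comNzRingType) :
  exists s : {rmorphism {poly {poly B}} -> {poly {poly B}}},
    [/\ involutive s, s 'X = 'X%:P, s 'X%:P = 'X & forall b, s b%:P%:P = b%:P%:P].
Proof.
exists (@swapXY B); split; [exact: swapXYK|exact: swapXY_X|exact: swapXY_Y|].
by move=> b; rewrite /= swapXY_polyC map_polyC.
Qed.

Section SplitCIC.

Variables (B C : comNzRingType) (p : B).
Variable pi : {rmorphism {poly {poly B}} -> C}.
Local Notation g := ('X%:P * 'X - p%:P%:P : {poly {poly B}}).
Hypothesis pi_surj : forall x, exists a, pi a = x.
Hypothesis pi_ker : forall a, pi a = 0 <-> divides g a.
Hypothesis domB : domain B.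
Hypothesis cicB : completely_closed B.
Hypothesis p_neq0 : p != 0.
Local Notation v := (pi 'X%:P).
Local Notation u := (pi 'X).

(** By [cic_away] for v and for u, w divides v^k y and u^l y.  The two quotients x
    and x' satisfy u^l x = v^k x', and (v, u) is a regular sequence, so v^k divides
    x and w divides y. *)
Lemma split_cic : completely_closed C.
Proof.
move=> c y w c0 w0 H.
have domC := split_domain pi_surj pi_ker domB p_neq0.
have [sw [swK swX swY swC]] := swap_variables B.
pose pi' : {rmorphism {poly {poly B}} -> C} := pi \o sw.
have pi'E a : pi' a = pi (sw a) by [].
clearbody pi'.
have surj' x : exists a, pi' a = x.
  by have [a <-] := pi_surj x; exists (sw a); rewrite pi'E swK.
have gS : sw g = g by rewrite rmorphB rmorphM swX swY swC mulrC.
have ker' a : pi' a = 0 <-> divides g a.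
  split=> [|/(divides_rmorph sw)]; last by rewrite gS pi'E => /pi_ker.
  by rewrite pi'E => /pi_ker/(divides_rmorph sw); rewrite gS swK.
have [k [x xE]] : exists k, divides w (v ^+ k * y).
  apply: (@cic_away _ _ (pi \o polyC) domB cicB domC _ _ c) => //.
    move=> a b /eqP; rewrite -subr_eq0 -rmorphB => /eqP/(split_const_inj pi_ker domB)/eqP.
    by rewrite subr_eq0 => /eqP.
  exact: (split_denom pi_surj pi_ker).
have [l [x' x'E]] : exists k, divides w (u ^+ k * y).
  have -> : u = pi' 'X%:P by rewrite pi'E swY.
  apply: (@cic_away _ _ (pi' \o polyC) domB cicB domC _ _ c) => //.
    move=> a b /eqP; rewrite -subr_eq0 -rmorphB => /eqP/(split_const_inj ker' domB)/eqP.
    by rewrite subr_eq0 => /eqP.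
  exact: (split_denom surj' ker').
have [q qE] : divides (v ^+ k) x.
  have : u ^+ l * x = v ^+ k * x'.
    apply: (domain_mulfI domC w0); transitivity (u ^+ l * (v ^+ k * y)); first by rewrite xE; ring.
    by transitivity (v ^+ k * (u ^+ l * y)); [ring|rewrite x'E; ring].
  elim: k x x' {xE x'E} => [|k IH] x x' E; first by exists x; rewrite mulr1.
  have reg : forall n, divides v (u ^+ n * x) -> divides v x.
    elim=> [|n IHn]; rewrite ?mul1r // exprS -mulrA.
    by move=> /(split_regular_mod pi_surj pi_ker domB p_neq0)/IHn.
  have [x1 x1E] : divides v x.
    by apply: (reg l); rewrite E exprS; exists (v ^+ k * x'); ring.
  have [q qE] : divides (v ^+ k) x1.
    apply: (IH _ x'); apply: (domain_mulfI domC (_ : v != 0)).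
      apply/negP => /eqP v0; have := @split_regular _ _ _ _ pi_surj pi_ker domB p_neq0 1.
      by rewrite v0 mul0r => /(_ erefl)/eqP; rewrite oner_eq0.
    transitivity (u ^+ l * x); first by rewrite x1E; ring.
    by rewrite E exprS; ring.
  by exists q; rewrite x1E qE exprS; ring.
exists q; apply: (domain_mulfI domC (_ : v ^+ k != 0)); last by rewrite xE qE; ring.
apply: domain_expf_neq0 => //; apply/negP => /eqP v0.
have := @split_regular _ _ _ _ pi_surj pi_ker domB p_neq0 1.
by rewrite v0 mul0r => /(_ erefl)/eqP; rewrite oner_eq0.
Qed.

End SplitCIC.

Lemma split_product2 (B : comNzRingType) (p : B) : domain B -> completely_closed B -> p != 0 ->
  exists (C : comNzRingType) (iota : {rmorphism B -> C}) (u v : C),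
    [/\ domain C, completely_closed C, injective iota, v * u = iota p
      & forall (X : comNzRingType) (f : {rmorphism B -> X}) (x y : X), x * y = f p ->
        exists h : {rmorphism C -> X}, [/\ forall b, h (iota b) = f b, h v = x & h u = y]].
Proof.
move=> domB cicB p0.
have [|C [pi [surj ker]]] := @principal_quotient _ ('X%:P * 'X - p%:P%:P : {poly {poly B}}).
  move=> [q /(congr1 (fun a : {poly {poly B}} => a.[p%:P].[1]))].
  by rewrite !hornerE subrr mulr0 => /eqP; rewrite oner_eq0.
exists C, (pi \o (polyC \o polyC)), (pi 'X), (pi 'X%:P); split.
- exact: split_domain surj ker domB p0.
- exact: split_cic surj ker domB cicB p0.
- exact: split_embed_inj ker domB.
- exact: split_mul ker.
- by move=> X f x y xy; have [h [h1 h2 h3]] := split_universal surj ker xy; exists h.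
Qed.

(** Split p into u and v, then v into the remaining factors. *)
Lemma split_product (m : nat) (B : comNzRingType) (p : B) :
  domain B -> completely_closed B -> p != 0 ->
  exists (C : comNzRingType) (iota : {rmorphism B -> C}) (s : nat -> C),
    [/\ domain C, completely_closed C, injective iota, \prod_(j < m.+1) s j = iota p
      & forall (X : comNzRingType) (f : {rmorphism B -> X}) (x : nat -> X),
        \prod_(j < m.+1) x j = f p ->
        exists h : {rmorphism C -> X},
          (forall b, h (iota b) = f b) /\ forall j, (j < m.+1)%N -> h (s j) = x j].
Proof.
elim: m B p => [|m IH] B p domB cicB p0.
  exists B, idfun, (fun=> p); split=> //; first by rewrite big_ord1.
  move=> X f x; rewrite big_ord1 => xp; exists f; split=> // -[|//] _.
  by rewrite xp.
have [C [i1 [u [v [domC cicC inj1 vu univ1]]]]] := split_product2 domB cicB p0.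
have v0 : v != 0.
  apply: contra_neq p0 => v0; apply: inj1; by rewrite rmorph0 -vu v0 mul0r.
have [D [i2 [s [domD cicD inj2 sE univ2]]]] := IH C v domC cicC v0.
exists D, (i2 \o i1), (fun j => if j == m.+1 then i2 u else s j); split=> //.
- exact: inj_comp.
- rewrite big_ord_recr /= eqxx -vu rmorphM -sE; congr (_ * _).
  by apply: eq_bigr => j _; rewrite (ltn_eqF (ltn_ord j)).
- move=> X f x; rewrite big_ord_recr /= => xE.
  have [h1 [h1E h1v h1u]] := univ1 X f _ _ xE.
  have [h2 [h2E h2s]] := univ2 X h1 x (esym h1v).
  exists h2; split=> [b|j] /=; first by rewrite h2E h1E.
  rewrite ltnS leq_eqVlt; case: eqP => [-> _|_ /= jm]; first by rewrite h2E h1u.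
  exact: h2s.
Qed.

Lemma split_products (m : nat) (n : nat -> nat) (B : comNzRingType) (p : nat -> B) :
  domain B -> completely_closed B -> (forall i, (i < m)%N -> p i != 0) -> (forall i, (0 < n i)%N) ->
  exists (C : comNzRingType) (iota : {rmorphism B -> C}) (s : nat -> nat -> C),
    [/\ domain C, completely_closed C, injective iota,
        forall i, (i < m)%N -> \prod_(j < n i) s i j = iota (p i)
      & forall (X : comNzRingType) (f : {rmorphism B -> X}) (x : nat -> nat -> X),
        (forall i, (i < m)%N -> \prod_(j < n i) x i j = f (p i)) ->
        exists h : {rmorphism C -> X}, (forall b, h (iota b) = f b) /\
          forall i j, (i < m)%N -> (j < n i)%N -> h (s i j) = x i j].
Proof.
move=> domB cicB p0 n0; elim: m p0 => [|m IH] p0.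
  exists B, idfun, (fun _ => p); split=> // X f x _; exists f; split=> //.
have [|C [i1 [s [domC cicC inj1 sE univ1]]]] := IH.
  by move=> i im; apply: p0; rewrite leqW.
have pm0 : i1 (p m) != 0.
  by apply: contra_neq (p0 m (ltnSn m)) => e; apply: inj1; rewrite e rmorph0.
have [D [i2 [t [domD cicD inj2]]]] := split_product (n m).-1 domC cicC pm0.
rewrite prednK // => tE univ2.
exists D, (i2 \o i1), (fun i j => if i == m then t j else i2 (s i j)); split=> //.
- exact: inj_comp.
- move=> i; rewrite ltnS leq_eqVlt; case: eqP => [-> _|_ /= im]; first exact: tE.
  by rewrite -sE // rmorph_prod.
- move=> X f x xE.
  have [|h1 [h1E h1s]] := univ1 X f x; first by move=> i im; rewrite xE // leqW.
  have [|h2 [h2E h2t]] := univ2 X h1 (x m); first by rewrite xE // h1E.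
  exists h2; split=> [b|i j] /=; first by rewrite h2E h1E.
  rewrite ltnS leq_eqVlt; case: eqP => [-> _ jm|_ /= im jn]; first exact: h2t.
  by rewrite h2E h1s.
Qed.

(** * Adjoining the variables to a pencil of lines *)

Section LinearElements.
Variables (K : fieldType) (M : nat).
Local Notation B := {poly {poly K}}.

(** With f_0 = X^M in the coefficient ring and f_1 the outer variable, [line x y] is
    x f_0 + y f_1; for y <> 0 it is linear in f_1 with root [line_root x y], so that
    divisibility by it is the vanishing of a value. *)
Definition line (x y : K) : B := y%:P%:P * 'X + (x%:P * 'X^M)%:P.
Definition line_root (x y : K) : {poly K} := - (x / y) *: 'X^M.

Lemma line_horner x y x' y' : y != 0 ->
  (line x' y').[line_root x y] = ((x' * y - x * y') / y) *: 'X^M.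
Proof.
move=> y0; rewrite /line /line_root !hornerE -!mul_polyC mulrA -rmorphM -mulrDl -rmorphD /=.
by congr (_%:P * _); field.
Qed.

Lemma divides_line x y (a : B) : y != 0 ->
  divides (line x y) a <-> a.[line_root x y] = 0.
Proof.
move=> y0; split=> [[q ->]|/eqP/factor_theorem[q ->]].
  by rewrite hornerM line_horner // subrr mul0r scale0r mulr0.
exists (q * (y^-1)%:P%:P); rewrite -mulrA; congr (_ * _).
rewrite /line /line_root mulrDr mulrA -!polyCM mulVf // !polyC1 mul1r -polyCN.
by congr (_ + _%:P); rewrite -scaleNr opprK mulrA -polyCM mul_polyC mulrC.
Qed.

Lemma line_neq0 x y : y != 0 -> line x y != 0.
Proof.
move=> y0; apply/eqP => /(congr1 (fun a : B => a`_1`_0)).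
by rewrite /line coefD coefMX coefC /= coefC addr0 !coef0 coefC /= => /eqP; rewrite (negPf y0).
Qed.

Lemma line_nonunit x y : y != 0 -> ~ divides (line x y) 1.
Proof. by move=> y0 /(divides_line _ _ y0)/eqP; rewrite hornerC oner_eq0. Qed.

Lemma line_radical x y : y != 0 -> radical_elt (line x y).
Proof.
move=> y0 a n /(divides_line _ _ y0)/eqP; rewrite horner_exp expf_eq0 => /andP[_ /eqP e].
exact/divides_line.
Qed.

Lemma line_regular x y x' y' : y != 0 -> x' * y != x * y' ->
  regular_mod (line x y) (line x' y').
Proof.
move=> y0 ne a /(divides_line _ _ y0)/eqP; rewrite hornerM mulf_eq0 line_horner //.
rewrite scale_poly_eq0 mulf_eq0 subr_eq0 (negPf ne) invr_eq0 (negPf y0) /=.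
by rewrite -size_poly_eq0 size_polyXn => /eqP e; apply/divides_line.
Qed.

End LinearElements.

(** The ring in which all exponents are M.  In K[Z_0, f_1] put f_0 = Z_0^M, adjoin
    M-th roots Z_i of the linear forms f_i = x_i f_0 + y_i f_1 for 0 < i <= r, and
    split each Z_i into the product of the s_ij.  The universal property says that
    the relations generate all others. *)
Lemma trinomial_cover (K : fieldType) (M : nat) (zeta : K) (r : nat)
    (x y : nat -> K) (n : nat -> nat) :
  (0 < M)%N -> M.-primitive_root zeta -> M%:R != 0 :> K ->
  (forall i, (0 < i <= r)%N -> y i != 0) ->
  (forall i j, (0 < i <= r)%N -> (0 < j <= r)%N -> i != j -> x j * y i != x i * y j) ->
  (forall i, (0 < n i)%N) ->
  exists (C : comNzRingType) (kappa : {rmorphism K -> C}) (s : nat -> nat -> C) (e : C),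
    [/\ domain C, completely_closed C,
        forall i, (0 < i <= r)%N -> (\prod_(j < n i) s i j) ^+ M =
          kappa (x i) * (\prod_(j < n 0) s 0 j) ^+ M + kappa (y i) * e
      & forall (X : comNzRingType) (f : {rmorphism K -> X}) (t : nat -> nat -> X) (e' : X),
        (forall i, (0 < i <= r)%N -> (\prod_(j < n i) t i j) ^+ M =
          f (x i) * (\prod_(j < n 0) t 0 j) ^+ M + f (y i) * e') ->
        exists h : {rmorphism C -> X}, (forall a, h (kappa a) = f a) /\
          forall i j, (i <= r)%N -> (j < n i)%N -> h (s i j) = t i j].
Proof.
move=> M0 zetaP MK y0 xy n0.
pose B := {poly {poly K}}; pose kB : {rmorphism K -> B} := polyC \o polyC.
pose p i : B := line M (x i.+1) (y i.+1).
have domB : domain B := @idomain_domain _.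
have cicB : completely_closed B.
  by apply/cic_poly; [exact: idomain_domain|apply/cic_poly; [exact: idomain_domain|exact: cic_field]].
have [||D [i1 [z [domD cicD inj1 zE univ1]]]] :=
  adjoin_roots (m := r) (p := p) M0 zetaP MK kB domB cicB.
- move=> i ir; have yi : y i.+1 != 0 by apply: y0.
  by split; [exact: line_neq0|exact: line_nonunit|exact: line_radical].
- by move=> i j ir jr ij; apply: line_regular; [apply: y0|apply: xy; rewrite ?eqSS].
pose q i := if i is j.+1 then z j else i1 'X%:P.
have [|C [i2 [s [domC cicC inj2 sE univ2]]]] := @split_products r.+1 n D q domD cicD _ n0.
  have nz (b : B) : b != 0 -> i1 b != 0.
    by apply: contra_neq => e; apply: inj1; rewrite e rmorph0.
  case=> [_|i ir] /=; first by apply: nz; rewrite polyC_eq0 polyX_eq0.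
  apply: contraTneq (nz (p i) (line_neq0 _ _ (y0 i.+1 _))) => // z0.
  by rewrite -zE // z0 expr0n eqn0Ngt M0 eqxx.
exists C, (i2 \o (i1 \o kB)), s, (i2 (i1 'X)); split=> //.
  case=> // i ir; transitivity (i2 (i1 (p i))).
    by rewrite (sE i.+1) //= -(rmorphXn i2) zE.
  rewrite (sE 0%N) //= /p /line addrC polyCM polyC_exp.
  by rewrite (rmorphD i1) !(rmorphM i1) (rmorphXn i1) (rmorphD i2) !(rmorphM i2) (rmorphXn i2).
move=> X f t e' tE.
pose F := \prod_(j < n 0) t 0 j.
have c1 : commr_rmorph f F by move=> b; apply: mulrC.
have c2 : commr_rmorph (horner_morph c1) e' by move=> b; apply: mulrC.
have [|g [gE gz]] := univ1 X (horner_morph c2) (fun i => \prod_(j < n i.+1) t i.+1 j).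
  move=> i ir; rewrite tE // /p /line rmorphD rmorphM /= horner_morphX !horner_morphC /=.
  by rewrite horner_morphC rmorphM rmorphXn /= horner_morphC horner_morphX addrC.
have [|h [hE hs]] := univ2 X g t.
  case=> [_|i ir] /=; last by rewrite gz.
  by rewrite gE /= horner_morphC /= horner_morphX.
exists h; split=> [a|i j ir jn]; last exact: hs.
by rewrite /= hE gE /= horner_morphC /= horner_morphC.
Qed.

(** * Free extensions containing roots *)

(** Adjoining roots z_k^e_k = a_k one by one gives at each step a free extension
    with basis 1, z, ..., z^(e-1), and rho takes the coefficient of 1. *)
Lemma root_retract (m : nat) (A : comNzRingType) (a : nat -> A) (e : nat -> nat) :
  (forall k, (0 < e k)%N) ->
  exists (X : comNzRingType) (iota : {rmorphism A -> X}) (z : nat -> X) (rho : X -> A),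
    [/\ forall k, (k < m)%N -> z k ^+ e k = iota (a k),
        forall b x, rho (iota b * x) = b * rho x & rho 1 = 1].
Proof.
move=> e0; elim: m A a => [|m IH] A a.
  by exists A, idfun, a, id.
have [X1 [pi [surj ker]]] := pure_quotient (a m) (e0 m).
pose i1 : {rmorphism A -> X1} := pure_embed pi.
pose rep x := projT1 (cid2 (pure_rep (e0 m) surj ker x)).
have rep_size x : (size (rep x) <= e m)%N by rewrite /rep; case: cid2.
have repK x : pi (rep x) = x by rewrite /rep; case: cid2.
have [X [i2 [z [rho [zE rhoM rho1]]]]] := IH X1 (i1 \o a).
exists X, (i2 \o i1), (fun k => if k == m then i2 (pi 'X) else z k), (fun x => (rep (rho x))`_0).
split=> [k|b x|].
- rewrite ltnS leq_eqVlt; case: eqP => [-> _|_ /= km]; last exact: zE.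
  by rewrite -rmorphXn (pure_root ker).
- rewrite /= rhoM; have -> : rep (i1 b * rho x) = b *: rep (rho x).
    apply: (pure_injB (e0 m) ker) => //; first exact: leq_trans (size_scale_leq _ _) _.
    by rewrite repK -mul_polyC rmorphM repK.
  by rewrite coefZ.
- rewrite rho1; have -> : rep 1 = 1%:P.
    apply: (pure_injB (e0 m) ker) => //; first by rewrite size_poly1.
    by rewrite repK rmorph1.
  by rewrite coefC.
Qed.

(** * Presentation of R by a pencil *)

Lemma rmorph_mpoly_ext (n : nat) (K A : comNzRingType) (f g : {rmorphism {mpoly K[n]} -> A}) :
  (forall a, f a%:MP = g a%:MP) -> (forall i, f 'X_i = g 'X_i) -> f =1 g.
Proof.
move=> eC eX p; rewrite (mpolyE p) !rmorph_sum; apply: eq_bigr => m _.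
rewrite -mul_mpolyC !rmorphM eC mpolyXE_id !rmorph_prod; congr (_ * _).
by apply: eq_bigr => i _; rewrite !rmorphXn eX.
Qed.

Lemma det2 (K : fieldType) (u v : 'cV[K]_2) :
  \det (row_mx u v) = u 0 0 * v 1 0 - u 1 0 * v 0 0.
Proof.
have E0 i : row_mx u v i 0 = u i 0.
  by rewrite -[RHS](row_mxEl u v); congr (row_mx _ _ _ _); apply: val_inj.
have E1 i : row_mx u v i 1 = v i 0.
  by rewrite -[RHS](row_mxEr u v); congr (row_mx _ _ _ _); apply: val_inj.
move: (row_mx u v) E0 E1 => /= A E0 E1.
rewrite (expand_det_row _ 0) !big_ord_recl big_ord0 addr0 /cofactor.
have -> : lift 0 0 = 1 :> 'I_2 by apply: val_inj.
rewrite !det_mx11 !mxE.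
have -> : lift 0 0 = 1 :> 'I_2 by apply: val_inj.
have -> : lift 1 0 = 0 :> 'I_2 by apply: val_inj.
by rewrite !E0 !E1 /= expr0 expr1; ring.
Qed.

Section Ring.
Variables (K : fieldType) (r : nat) (t : trinomial_data K r).
Hypothesis r_gt0 : (0 < r)%N.
Local Notation P := {mpoly K[nvars t]}.
Local Notation R := (trinomial_ring t).

Definition trinomial_proj : P -> R := (\pi_({ideal_quot [the idealr P of relation_ideal t]}))%qT.
HB.instance Definition _ := GRing.RMorphism.on trinomial_proj.

Lemma trinomial_proj_surj x : exists p, trinomial_proj p = x.
Proof. by exists (repr x); exact: reprK. Qed.

Lemma trinomial_proj_ker p : trinomial_proj p = 0 <-> relation_ideal t p.
Proof.
rewrite -(rmorph0 trinomial_proj); split=> [e|h].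
  have : p - 0 \in [the idealr P of relation_ideal t] by rewrite Quotient.idealrBE; apply/eqP.
  by rewrite subr0.
by apply/eqP; rewrite /trinomial_proj -Quotient.idealrBE subr0.
Qed.

Definition trinomial_const : K -> R := trinomial_proj \o @mpolyC (nvars t) K.
HB.instance Definition _ :=
  GRing.RMorphism.copy trinomial_const (trinomial_proj \o @mpolyC (nvars t) K).

Lemma alphaE i j : alpha t i j = vec t i 0 0 * vec t j 1 0 - vec t i 1 0 * vec t j 0 0.
Proof. exact: det2. Qed.

Lemma alpha_neq0 i j : i != j -> alpha t i j != 0.
Proof.
rewrite eq_sym => ij; have := vec_free t ij.
rewrite free_cons span_seq1 seq1_free => /andP[ni v0]; rewrite alphaE.
apply: contraNneq ni => /eqP; rewrite subr_eq0 => /eqP e.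
set u := vec t i in e *; set v := vec t j in v0 e *.
have [k vk] : exists k, v k 0 != 0.
  apply/existsP; apply: contraNT v0; rewrite negb_exists => /forallP h.
  by apply/eqP/matrixP => k l; rewrite mxE (ord1 l); apply/eqP; have := h k; rewrite negbK.
apply/vlineP; exists (u k 0 / v k 0); apply/matrixP => l l'; rewrite mxE (ord1 l').
apply: (mulIf vk); rewrite mulrAC divfK //.
have I2 (x : 'I_2) : x = 0 \/ x = 1.
  by case: x => [[|[|//]]] h; [left|right]; apply: val_inj.
by case: (I2 k) => ->; case: (I2 l) => -> //; rewrite 1?mulrC ?e 1?mulrC // -?e mulrC.
Qed.

Lemma alpha_plucker i j k l :
  alpha t j k * alpha t i l + alpha t k i * alpha t j l + alpha t i j * alpha t k l = 0.
Proof. by rewrite !alphaE; ring. Qed.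

Local Notation i0 := (ord0 : 'I_r.+1).
Local Notation i1 := (inord 1 : 'I_r.+1).

Lemma i01_neq : i0 != i1.
Proof. by apply/eqP => /(congr1 val); rewrite /= inordK. Qed.

(** The coordinates of the vector a_i in the basis a_0, a_1: by the relations,
    f_i = pencilX i * f_0 + pencilY i * f_1. *)
Definition pencilX i := alpha t i i1 / alpha t i0 i1.
Definition pencilY i := alpha t i0 i / alpha t i0 i1.

Lemma pencilX0 : pencilX i0 = 1. Proof. by rewrite /pencilX divff // alpha_neq0 // i01_neq. Qed.
Lemma pencilX1 : pencilX i1 = 0.
Proof. by rewrite /pencilX alphaE [X in X - _]mulrC subrr mul0r. Qed.
Lemma pencilY0 : pencilY i0 = 0.
Proof. by rewrite /pencilY alphaE [X in X - _]mulrC subrr mul0r. Qed.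
Lemma pencilY1 : pencilY i1 = 1. Proof. by rewrite /pencilY divff // alpha_neq0 // i01_neq. Qed.

Lemma pencilY_neq0 i : i != i0 -> pencilY i != 0.
Proof.
move=> ii; rewrite mulf_neq0 ?invr_eq0 ?alpha_neq0 //; last exact: i01_neq.
by rewrite eq_sym.
Qed.

Lemma pencilXY_neq i j : i != j -> pencilX j * pencilY i != pencilX i * pencilY j.
Proof.
move=> ij; rewrite -subr_eq0.
have a0 : alpha t i0 i1 != 0 by rewrite alpha_neq0 // i01_neq.
have -> : pencilX j * pencilY i - pencilX i * pencilY j = - (alpha t i j / alpha t i0 i1).
  apply: (mulIf (expf_neq0 2 a0)); rewrite /pencilX /pencilY !alphaE.
  by move: a0; rewrite alphaE => a0; field.
by rewrite oppr_eq0 mulf_neq0 ?invr_eq0 // alpha_neq0.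
Qed.

(** The Pluecker identity, applied to each coordinate of the vectors a_i. *)
Lemma pencil_relation (A : comNzRingType) (f : {rmorphism K -> A}) (a b : A) i j k :
  f (alpha t j k) * (f (pencilX i) * a + f (pencilY i) * b) +
  f (alpha t k i) * (f (pencilX j) * a + f (pencilY j) * b) +
  f (alpha t i j) * (f (pencilX k) * a + f (pencilY k) * b) = 0.
Proof.
transitivity (f (alpha t j k * pencilX i + alpha t k i * pencilX j + alpha t i j * pencilX k) * a +
  f (alpha t j k * pencilY i + alpha t k i * pencilY j + alpha t i j * pencilY k) * b).
  by rewrite !rmorphD !rmorphM; ring.
rewrite /pencilX /pencilY !mulrA -!mulrDl alpha_plucker mul0r rmorph0 mul0r add0r.
have -> : alpha t j k * alpha t i0 i + alpha t k i * alpha t i0 j + alpha t i j * alpha t i0 k = 0.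
  by rewrite !alphaE; ring.
by rewrite mul0r rmorph0 mul0r.
Qed.

Lemma trinomial_projZ a p : trinomial_proj (a *: p) = trinomial_const a * trinomial_proj p.
Proof. by rewrite -mul_mpolyC rmorphM. Qed.

(** The relation g_(k,k+1,k+2) determines f_(k+2) by f_k and f_(k+1), because
    alpha_(k,k+1) <> 0, and the right-hand side satisfies the same recursion. *)
Lemma trinomial_proj_monom i :
  trinomial_proj (monom t i) =
    trinomial_const (pencilX i) * trinomial_proj (monom t i0) +
    trinomial_const (pencilY i) * trinomial_proj (monom t i1).
Proof.
pose E (i : 'I_r.+1) := trinomial_const (pencilX i) * trinomial_proj (monom t i0) +
  trinomial_const (pencilY i) * trinomial_proj (monom t i1).
suff H (k : nat) : (k <= r)%N -> trinomial_proj (monom t (inord k)) = E (inord k).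
  by rewrite -[i]inord_val; apply: H; rewrite -ltnS.
elim/ltn_ind: k => -[|[|k]] IH kr.
- have -> : inord 0 = i0 by apply: val_inj; rewrite /= inordK.
  by rewrite /E pencilX0 pencilY0 rmorph0 mul0r addr0 rmorph1 mul1r.
- by rewrite /E pencilX1 pencilY1 rmorph0 mul0r add0r rmorph1 mul1r.
have kr' : (k < r.-1)%N by lia.
have : trinomial_proj (@relation K r t (Ordinal kr')) = 0.
  apply/trinomial_proj_ker/asboolP; exists (fun l => (l == Ordinal kr')%:R).
  rewrite (bigD1 (Ordinal kr')) //= eqxx mul1r big1 ?addr0 // => l /negPf->.
  by rewrite mul0r.
rewrite /relation /trinom !rmorphD /= !trinomial_projZ (IH k) ?(IH k.+1) //; try lia.
have := pencil_relation trinomial_const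
  (trinomial_proj (monom t i0)) (trinomial_proj (monom t i1)) (inord k) (inord k.+1) (inord k.+2).
rewrite -/(E _) -/(E _) -/(E _) => <- /addrI/eqP; rewrite -subr_eq0 -mulrBr => /eqP e.
apply/eqP; rewrite -subr_eq0; apply/eqP.
have a0 : alpha t (inord k) (inord k.+1) != 0.
  apply: alpha_neq0; apply/eqP => /(congr1 val); rewrite /= !inordK; lia.
rewrite -[LHS]mul1r -(rmorph1 trinomial_const) -(mulVf a0) rmorphM -mulrA.
by rewrite e mulr0.
Qed.

Lemma trinomial_lift (A : comNzRingType) (f : {rmorphism K -> A}) (v : nat -> nat -> A) (a b : A) :
  (forall i : 'I_r.+1, \prod_(j < blk t i) v i j ^+ expo t i j =
    f (pencilX i) * a + f (pencilY i) * b) ->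
  exists h : {rmorphism R -> A}, (forall c, h (trinomial_const c) = f c) /\
    forall i (j : 'I_(blk t i)), h (trinomial_proj (Tvar t i j)) = v i j.
Proof.
move=> vE.
pose g : {rmorphism P -> A} := mmap f (fun k => v (tagnat.sig1 k) (tagnat.sig2 k)).
have gv i (j : 'I_(blk t i)) : g (Tvar t i j) = v i j.
  rewrite /g /Tvar /= mmapX mmap1U; congr v; first by rewrite tagnat.Rank1K.
  by rewrite tagnat.Rank2K.
have gm i : g (monom t i) = f (pencilX i) * a + f (pencilY i) * b.
  by rewrite -vE /monom rmorph_prod; apply: eq_bigr => j _; rewrite rmorphXn gv.
have gC c : g c%:MP = f c by rewrite /g /= mmapC.
have gZ c p : g (c *: p) = f c * g p by rewrite -mul_mpolyC rmorphM gC.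
have [p|h hE] := @rmorph_factor _ _ _ (trinomial_proj : {rmorphism P -> R}) g trinomial_proj_surj.
  move=> /trinomial_proj_ker/asboolP[c ->]; rewrite rmorph_sum big1 // => k _.
  by rewrite rmorphM /relation /trinom !rmorphD /= !gZ !gm pencil_relation mulr0.
exists h; split=> [c|i j]; first by rewrite /trinomial_const /= hE gC.
by rewrite hE gv.
Qed.

End Ring.

(** * Normality *)

(** X^M - 1 is separable, so it has M distinct roots. *)
Lemma exists_primitive_root (K : closedFieldType) (M : nat) :
  (0 < M)%N -> M%:R != 0 :> K -> exists zeta : K, M.-primitive_root zeta.
Proof.
move=> M0 MK; have [rs rsE] := closed_field_poly_normal ('X^M - 1 : {poly K}).
have lc : lead_coef ('X^M - 1 : {poly K}) = 1.
  by apply/eqP; rewrite -monicE monicXnsubC.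
rewrite lc scale1r in rsE.
have srs : size rs = M.
  have : size ('X^M - 1 : {poly K}) = (size rs).+1 by rewrite rsE size_prod_XsubC.
  by rewrite size_XnsubC // => -[].
have urs : uniq rs by rewrite -separable_prod_XsubC -rsE separable_Xn_sub_1.
have ars : all M.-unity_root rs.
  by apply/allP => x xrs; rewrite /root_of_unity rsE root_prod_XsubC.
by have /hasP[zeta _] := has_prim_root M0 ars urs (eq_leq (esym srs)); exists zeta.
Qed.

Section Exponents.
Variables (K : fieldType) (r : nat) (t : trinomial_data K r).

Definition common_expo : nat := (\prod_(i < r.+1) \prod_(j < blk t i) expo t i j)%N.
Local Notation M := common_expo.

Lemma common_expo_gt0 : (0 < M)%N.
Proof. by apply: prodn_gt0 => i; apply: prodn_gt0 => j; apply: expo_gt0. Qed.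

Lemma dvdn_common_expo i j : (expo t i j %| M)%N.
Proof.
rewrite /M (bigD1 i) //= dvdn_mulr // (bigD1 j) //= dvdn_mulr //.
Qed.

Definition coexpo i (j : 'I_(blk t i)) : nat := (M %/ expo t i j)%N.

Lemma coexpoK i (j : 'I_(blk t i)) : (coexpo j * expo t i j)%N = M.
Proof. by rewrite divnK // dvdn_common_expo. Qed.

Lemma coexpo_gt0 i (j : 'I_(blk t i)) : (0 < coexpo j)%N.
Proof.
by have := common_expo_gt0; rewrite -(coexpoK j) muln_gt0 => /andP[].
Qed.

(** Families indexed by pairs of natural numbers avoid transporting along
    equalities between block indices; d is the value outside the blocks. *)
Definition totalize (A : Type) (d : A) (f : forall i, 'I_(blk t i) -> A) (i j : nat) : A :=
  if insub j is Some j' then f (inord i) j' else d.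

Lemma totalizeE (A : Type) (d : A) f (i : 'I_r.+1) (j : 'I_(blk t i)) :
  totalize d f i j = f i j.
Proof.
rewrite /totalize; have e := inord_val i; move: (inord _) e j => k ->.
by move=> j; rewrite valK.
Qed.

Lemma tagnat_Rank (A : Type) (F : forall i, 'I_(blk t i) -> A) i (j : 'I_(blk t i)) :
  F _ (tagnat.sig2 (tagnat.Rank i j)) = F i j.
Proof.
have := @tagnat.rankK _ (blk t) (Tagged (fun k => 'I_(blk t k)) j).
by move=> /(congr1 (fun p => F (tag p) (tagged p))).
Qed.

End Exponents.

Section Normality.
Variables (K : closedFieldType) (r : nat) (t : trinomial_data K r).
Hypothesis r_gt0 : (0 < r)%N.
Hypothesis charK : [pchar K] =i pred0.
Local Notation P := {mpoly K[nvars t]}.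
Local Notation R := (trinomial_ring t).
Local Notation M := (common_expo t).
Local Notation coexpo := (@coexpo K r t).

(** The map alpha sends T_ij to s_ij^(M/l_ij).  In a free extension X of R with
    roots z_ij of T_ij of order M/l_ij, the z_ij satisfy the relations of the cover,
    which gives beta with beta(s_ij) = z_ij.  So beta o alpha is the inclusion of R
    into X, and rho retracts it. *)
Lemma trinomial_summand : exists (C X : comNzRingType) (alpha : {rmorphism R -> C})
    (beta : {rmorphism C -> X}) (rho : X -> R),
  [/\ domain C, completely_closed C, forall x y, rho (beta (alpha x) * y) = x * rho y & rho 1 = 1].
Proof.
have MK : M%:R != 0 :> K by rewrite ((pcharf0P K).1 charK) -lt0n common_expo_gt0.
have [zeta zetaP] := exists_primitive_root (common_expo_gt0 t) MK.
pose n i := blk t (inord i).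
have [|||C [kappa [s [e [domC cicC sE univ]]]]] :=
  @trinomial_cover K M zeta r (fun i => pencilX t (inord i)) (fun i => pencilY t (inord i)) n
  (common_expo_gt0 t) zetaP MK.
- move=> i /andP[i0 ir]; apply: pencilY_neq0 => //; apply/eqP => /(congr1 val).
  by rewrite /= inordK ?ltnS // => ei; rewrite ei in i0.
- move=> i j /andP[_ ir] /andP[_ jr] ij; apply: pencilXY_neq => //.
  by apply: contra_neq ij => /(congr1 val); rewrite /= !inordK.
- by move=> i; apply: blk_gt0.
have [|alpha [alphaC alphaT]] := @trinomial_lift K r t C kappa
    (fun i j => s i j ^+ totalize 1%N coexpo i j) ((\prod_(j < n 0%N) s 0%N j) ^+ M) e.
  move=> i; transitivity ((\prod_(j < n i) s i j) ^+ M).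
    rewrite /n inord_val -prodrXl; apply: eq_bigr => j _.
    by rewrite totalizeE -exprM coexpoK.
  have [i0|i0] := posnP i.
    have -> : i = ord0 by apply: val_inj.
    by rewrite pencilX0 ?pencilY0 // rmorph1 rmorph0 mul1r mul0r addr0.
  by rewrite sE ?inord_val // i0 /= -ltnS ltn_ord.
pose a (k : nat) : R := if insub k is Some k' then trinomial_proj (mpolyX _ U_(k')) else 0.
pose ex (k : nat) : nat :=
  if @insub _ _ 'I_(nvars t) k is Some k' then coexpo (tagnat.sig2 k') else 1%N.
have ex0 k : (0 < ex k)%N by rewrite /ex; case: insub => // k'; apply: coexpo_gt0.
have [X [iota [z [rho [zE rhoM rho1]]]]] := root_retract (nvars t) a ex0.
pose tz := totalize 0 (fun i (j : 'I_(blk t i)) => z (tagnat.Rank i j)).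
have tzE i (j : 'I_(blk t i)) : tz i j ^+ coexpo j = iota (trinomial_proj (Tvar t i j)).
  rewrite /tz totalizeE; have := zE (tagnat.Rank i j) (ltn_ord _).
  rewrite /a /ex !valK => <-; congr (_ ^+ _).
  by rewrite (tagnat_Rank coexpo).
have tz_monom i : (i <= r)%N ->
    (\prod_(j < n i) tz i j) ^+ M = iota (trinomial_proj (monom t (inord i))).
  move=> ir; rewrite /monom /n -prodrXl !rmorph_prod; apply: eq_bigr => j _.
  by have := tzE _ j; rewrite inordK // -(coexpoK j) exprM => ->; rewrite !rmorphXn.
have inord0 : inord 0 = ord0 :> 'I_r.+1 by apply: val_inj; rewrite /= inordK.
have [|beta [betaC betas]] := univ X (iota \o @trinomial_const K r t) tz
  (iota (trinomial_proj (monom t (inord 1)))).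
  move=> i /andP[_ ir]; rewrite tz_monom // (tz_monom 0%N) // inord0 [in LHS]trinomial_proj_monom //.
  by rewrite rmorphD !rmorphM.
exists C, X, alpha, beta, rho; split=> // x y; rewrite -rhoM; congr (rho (_ * y)).
have [p <-] := trinomial_proj_surj x.
apply: (@rmorph_mpoly_ext _ _ _ 
  (beta \o (alpha \o @trinomial_proj K r t)) (iota \o @trinomial_proj K r t)).
  by move=> c /=; have := betaC c; rewrite -alphaC.
move=> k /=; have -> : 'X_k = Tvar t _ (tagnat.sig2 k) by rewrite /Tvar tagnat.sig2K.
rewrite alphaT rmorphXn /= betas; last by rewrite /n inord_val.
  by rewrite totalizeE tzE.
by rewrite -ltnS.
Qed.

Lemma trinomial_domain_cic : domain R /\ completely_closed R.
Proof.
have [C [X [alpha [beta [rho [domC cicC rhoM rho1]]]]]] := trinomial_summand.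
have inj x : alpha x = 0 -> x = 0.
  by move=> e; rewrite -[x]mulr1 -rho1 -rhoM e rmorph0 mul0r -(mul0r 1) -(rmorph0 beta)
    -(rmorph0 alpha) rhoM mul0r.
split=> [x y xy|c y w c0 w0 H].
  have /domC/orP[] : alpha x * alpha y = 0 by rewrite -rmorphM xy rmorph0.
    by move=> /eqP/inj->; rewrite eqxx.
  by move=> /eqP/inj->; rewrite eqxx orbT.
have [|||q qE] := cicC (alpha c) (alpha y) (alpha w).
- by apply: contra_neq c0 => /inj.
- by apply: contra_neq w0 => /inj.
- by move=> N; rewrite -!rmorphXn -rmorphM; apply: divides_rmorph.
- exists (rho (beta q)); rewrite -[LHS]mulr1 -rho1 -rhoM qE rmorphM mulr1.
  by rewrite [RHS]mulrC -rhoM mulrC.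
Qed.

End Normality.

(** * Chains of primes and algebraic independence *)

(** Lowest term argument.  Choose x_i in p_(i+1) but not in p_i.  Given a relation
    between the monomials in the x_i, keep at stage k only the terms of least
    exponent in x_k: dividing by that power of x_k, which is not in p_k, and
    discarding the other terms, which are multiples of x_k in p_(k+1), the
    remaining sum lies in p_(k+1).  At the end a single coefficient lies in p_e,
    so it cannot be invertible. *)
Lemma chain_independent (K : fieldType) (S : comNzRingType) (kappa : {rmorphism K -> S})
    (e : nat) (p : 'I_e.+1 -> prime_idealr S) : prime_chain p ->
  exists x : 'I_e -> S, forall N (c : {ffun 'I_e -> 'I_N} -> K),
    \sum_m kappa (c m) * \prod_(i < e) x i ^+ m i = 0 -> forall m, c m = 0.
Proof.
move=> chain.
have sub (k : nat) : (k < e)%N -> {subset p (inord k) <= p (inord k.+1)}.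
  by move=> ke; have [] := chain (inord k) (inord k.+1); rewrite // !inordK // ltnW.
have /choice[x xP] (i : 'I_e) : exists x, x \in p (inord i.+1) /\ x \notin p (inord i).
  have [|_ [x x1 x2]] := chain (inord i) (inord i.+1); last by exists x.
  by rewrite !inordK // ltnS // ltnW.
exists x => N c cE m1; apply/eqP/negPn/negP => cm1.
have inv (k : nat) : (k <= e)%N -> exists A : {set {ffun 'I_e -> 'I_N}},
    [/\ A != set0, forall m, m \in A -> c m != 0,
        forall m m', m \in A -> m' \in A -> forall i : 'I_e, (i < k)%N -> m i = m' i
      & \sum_(m in A) kappa (c m) * \prod_(i < e | (k <= i)%N) x i ^+ m i \in p (inord k)].
  elim: k => [_|k IH ke].
    exists [set m | c m != 0]; split=> //; first by apply/set0Pn; exists m1; rewrite inE.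
      by move=> m; rewrite inE.
    suff -> : \sum_(m in [set m | c m != 0]) kappa (c m) * \prod_(i < e | (0 <= i)%N) x i ^+ m i = 0.
      exact: idealr0.
    rewrite -[RHS]cE [RHS](bigID (mem [set m | c m != 0])) /= [X in _ = _ + X]big1 ?addr0 //.
    by move=> m; rewrite inE negbK => /eqP->; rewrite rmorph0 mul0r.
  have [A [/set0Pn[m2 m2A] cA eqA inA]] := IH (ltnW ke).
  pose ik := Ordinal ke; have [xk1 xk2] := xP ik.
  have [m0 m0A m0min] := @arg_minnP _ m2 (mem A) (fun m => m ik : nat) m2A.
  pose a := (m0 ik : nat).
  exists [set m in A | m ik == m0 ik]; split.
  - by apply/set0Pn; exists m0; rewrite inE eqxx andbT; apply: m0A.
  - by move=> m; rewrite inE => /andP[/cA].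
  - move=> m m'; rewrite !inE => /andP[mA /eqP mk] /andP[m'A /eqP m'k] i.
    rewrite ltnS leq_eqVlt => /orP[/eqP ei|]; last exact: eqA.
    have -> : i = ik by apply: val_inj.
    by rewrite mk m'k.
  pose T m := kappa (c m) * \prod_(i < e | (k < i)%N) x i ^+ m i.
  have prodE m : \prod_(i < e | (k <= i)%N) x i ^+ m i =
      x ik ^+ m ik * \prod_(i < e | (k < i)%N) x i ^+ m i.
    rewrite (bigD1 ik) //=; congr (_ * _); apply: eq_bigl => i.
    by rewrite ltn_neqAle eq_sym andbC.
  pose Z := \sum_(m in A | m ik != m0 ik) x ik ^+ (m ik - a).-1 * T m.
  have sumE : \sum_(m in A) kappa (c m) * \prod_(i < e | (k <= i)%N) x i ^+ m i =
      x ik ^+ a * (\sum_(m in [set m in A | m ik == m0 ik]) T m + x ik * Z).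
    rewrite mulrDr (bigID (fun m : {ffun 'I_e -> 'I_N} => m ik == m0 ik)) /= !mulr_sumr.
    congr (_ + _).
      apply: eq_big => [m|m /andP[_ /eqP mk]]; first by rewrite inE.
      by rewrite prodE mk /T /a mulrCA.
    apply: eq_bigr => m /andP[mA mk]; rewrite prodE /T.
    have lt : (a < m ik)%N by rewrite ltn_neqAle m0min // andbT eq_sym.
    have -> : x ik ^+ m ik = x ik ^+ a * (x ik * x ik ^+ (m ik - a).-1).
      by rewrite -exprS -exprD prednK ?subn_gt0 // subnKC // ltnW.
    by ring.
  have notin n : x ik ^+ n \notin p (inord k).
    elim: n => [|n IHn]; first by rewrite expr0 idealr1.
    by rewrite exprS prime_idealrM negb_or xk2.
  move: inA; rewrite sumE prime_idealrM (negPf (notin a)) /= => /(sub _ ke) h.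
  have : x ik * Z \in p (inord k.+1) by rewrite mulrC idealMr.
  by move=> h2; rewrite -(rpredDr _ h2).
have [A [/set0Pn[m mA] cA eqA]] := inv e (leqnn e).
have -> : A = [set m].
  apply/setP => m'; rewrite inE; apply/idP/eqP => [m'A|-> //].
  by apply/ffunP => i; apply: eqA.
rewrite big_set1 big_pred0 => [|i]; last by rewrite leqNgt ltn_ord.
rewrite mulr1 => h; have : 1 \in p (inord e).
  by rewrite -(rmorph1 kappa) -(mulVf (cA m mA)) rmorphM idealMr.
by rewrite idealr1.
Qed.

(** F is a filtration of S, and S grows like D^d.  A chain of length e > d would
    give independent elements x_i in F_w; the N^e monomials with exponents below N
    lie in F_(ewN), of dimension O(N^d), which is a contradiction for large N. *)
Lemma dim_bound (K : fieldType) (S : comNzRingType) (kappa : {rmorphism K -> S})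
    (F : nat -> S -> Prop) (C d : nat) :
  (forall x, exists D, F D x) -> F 0%N 1 ->
  (forall D D' x, (D <= D')%N -> F D x -> F D' x) ->
  (forall D D' x y, F D x -> F D' y -> F (D + D')%N (x * y)) ->
  (forall D, exists q (s : 'I_q -> S), (q <= C * D.+1 ^ d)%N /\
     forall x, F D x -> exists a : 'I_q -> K, x = \sum_(i < q) kappa (a i) * s i) ->
  forall (e : nat) (p : 'I_e.+1 -> prime_idealr S), prime_chain p -> (e <= d)%N.
Proof.
move=> Fex F1 Fle FM Fspan e p /(chain_independent kappa)[x xind].
rewrite leqNgt; apply/negP => de.
have /choice[w0 w0P] (i : 'I_e) : exists D, F D (x i) by [].
pose w := (\max_i w0 i)%N.
have wP i : F w (x i) by apply: Fle (w0P i); apply: leq_bigmax.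
(* With this N, C (ewN + 1)^d <= C (ew + 1)^d N^d < N^(d+1). *)
pose N := (C * (e * w).+1 ^ d).+1.
pose T := {ffun 'I_e -> 'I_N} : finType.
pose y (m : T) := \prod_(i < e) x i ^+ m i.
have FX n i : F (w * n)%N (x i ^+ n).
  by elim: n => [|n IH]; rewrite ?muln0 // mulnS exprS; apply: FM.
have Fy m : F (e * (w * N))%N (y m).
  rewrite /y -{1}(card_ord e) -sum_nat_const.
  elim/big_rec2: _ => // i D z _ Fz; apply: FM => //.
  by apply: Fle (FX _ _); rewrite leq_mul2l (ltnW (ltn_ord _)) orbT.
have [q [s [qle sP]]] := Fspan (e * (w * N))%N.
have /choice[a aE] m : exists a : 'I_q -> K, y m = \sum_(i < q) kappa (a i) * s i by apply: sP.
pose A : 'M[K]_(#|T|, q) := \matrix_(k, i) a (enum_val k) i.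
have qT : (q < #|T|)%N.
  rewrite card_ffun !card_ord; apply: leq_ltn_trans qle _.
  have mono a1 a2 : (a1 <= a2)%N -> (a1 ^ d <= a2 ^ d)%N.
    by case: (d) => // d' h; rewrite leq_exp2r.
  apply: (@leq_ltn_trans (C * ((e * w).+1 * N) ^ d)).
    by rewrite leq_mul2l mono ?orbT //; rewrite mulnA mulSn -add1n leq_add2r.
  apply: (@leq_trans (N ^ d.+1)); last by rewrite leq_pexp2l.
  by rewrite expnMn mulnA expnS ltn_pmul2r ?expn_gt0.
have [u uA u0] : exists2 u : 'rV[K]_#|T|, u *m A = 0 & u != 0.
  have : kermx A != 0.
    rewrite -mxrank_eq0 mxrank_ker -lt0n subn_gt0.
    exact: leq_ltn_trans (rank_leq_col A) qT.
  by move=> /rowV0Pn[u /sub_kermxP uA u0]; exists u.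
pose c (m : T) := u 0 (enum_rank m).
have c0 : forall m, c m = 0.
  apply: xind.
  transitivity (\sum_(i < q) kappa ((u *m A) 0 i) * s i); last first.
    by rewrite uA big1 // => i _; rewrite mxE rmorph0 mul0r.
  transitivity (\sum_m \sum_(i < q) kappa (c m * a m i) * s i).
    apply: eq_bigr => m _; rewrite -/(y m) aE mulr_sumr; apply: eq_bigr => i _.
    by rewrite rmorphM mulrA.
  rewrite exchange_big; apply: eq_bigr => i _; rewrite mxE rmorph_sum mulr_suml /=.
  rewrite [RHS](reindex (@enum_rank T)) /=; last first.
    by exists enum_val => m _; rewrite ?enum_rankK ?enum_valK.
  by apply: eq_bigr => m _; rewrite mxE enum_rankK.
case/eqP: u0; apply/rowP => k; rewrite mxE -[k]enum_valK.
exact: c0.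
Qed.

(** * Growth of R and the upper bound for the dimension *)

Section Weights.
Variables (n : nat) (om : 'I_n -> nat).

Definition weight (m : 'X_{1..n}) : nat := (\sum_k om k * m k)%N.

Lemma weightD m m' : weight (m + m')%MM = (weight m + weight m')%N.
Proof.
rewrite /weight -big_split; apply: eq_bigr => k _.
by rewrite mnmDE mulnDr.
Qed.

Lemma weight0 : weight 0%MM = 0%N.
Proof. by rewrite /weight big1 // => k _; rewrite mnm0E muln0. Qed.

End Weights.

Lemma card_truncated_box (n D L : nat) (J : {set 'I_n}) :
  (#|[set m : {ffun 'I_n -> 'I_D.+1} | [forall k in J, (m k < L)%N]]| <=
   L ^ #|J| * D.+1 ^ (n - #|J|))%N.
Proof.
pose F (k : 'I_n) : {pred 'I_D.+1} := [pred x : 'I_D.+1 | (k \in J) ==> (x < L)%N].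
have -> : #|[set m : {ffun 'I_n -> 'I_D.+1} | [forall k in J, (m k < L)%N]]| = #|family F|.
  by apply: eq_card => m; rewrite inE; apply/forallP/familyP.
rewrite card_family (_ : foldr _ _ _ = \prod_k #|F k|)%N; last first.
  by rewrite /image_mem foldrE big_map big_enum.
rewrite (bigID (mem J)) /= leq_mul //.
  rewrite -prod_nat_const leq_prod // => k kJ.
  rewrite -[leqRHS](size_iota 0) cardE -(size_map val); apply: uniq_leq_size.
    by rewrite map_inj_uniq ?enum_uniq //; apply: val_inj.
  by move=> x /mapP[y]; rewrite mem_enum inE kJ mem_iota => h ->.
apply: (@leq_trans (\prod_(k < n | k \notin J) D.+1)).
  by apply: leq_prod => k _; rewrite -[leqRHS]card_ord max_card.
rewrite prod_nat_const (_ : #|_| = n - #|J|)%N //.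
by rewrite -[X in (X - _)%N]card_ord -(cardC J) addKn; apply: eq_card.
Qed.

Section DimensionBound.
Variables (K : fieldType) (r : nat) (t : trinomial_data K r).
Hypothesis r_gt0 : (0 < r)%N.
Local Notation P := {mpoly K[nvars t]}.
Local Notation R := (trinomial_ring t).
Local Notation n := (nvars t).

(** The exponent vector of f_i. *)
Definition mexp (i : 'I_r.+1) : 'X_{1..n} :=
  (\sum_(j < blk t i) U_(tagnat.Rank i j) *+ expo t i j)%MM.

Lemma monomE i : monom t i = 'X_[mexp i].
Proof. exact: mprodXnE. Qed.

Lemma weight_mexp om i :
  weight om (mexp i) = (\sum_(j < blk t i) om (tagnat.Rank i j) * expo t i j)%N.
Proof.
rewrite /weight /mexp; under eq_bigr do rewrite mnm_sumE big_distrr.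
rewrite exchange_big; apply: eq_bigr => j _ /=.
rewrite (bigD1 (tagnat.Rank i j)) //= mulmnE mnm1E eqxx mul1n.
rewrite [X in (_ + X)%N]big1 ?addn0 // => k kj.
by rewrite mulmnE mnm1E eq_sym (negPf kj) mul0n muln0.
Qed.

Lemma mexpE i j : mexp i (tagnat.Rank i j) = expo t i j.
Proof.
rewrite /mexp mnm_sumE (bigD1 j) //= mulmnE mnm1E eqxx mul1n.
rewrite [X in (_ + X)%N]big1 ?addn0 // => j' jj'.
by rewrite mulmnE mnm1E -val_eqE /= tagnat.eq_Rank eqxx /= val_eqE (negPf jj').
Qed.

Lemma mexp_out i k : tagnat.sig1 k != i -> mexp i k = 0%N.
Proof.
move=> ki; rewrite /mexp mnm_sumE big1 // => j _; rewrite mulmnE mnm1E.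
by case: eqP => // e; move: ki; rewrite -e tagnat.Rank1K eqxx.
Qed.

(** No f_i with i >= 2 divides the monomial with exponent m. *)
Definition standard (m : 'I_n -> nat) : bool :=
  [forall i : 'I_r.+1, (1 < i)%N ==> [exists j, m (tagnat.Rank i j) < expo t i j]%N].

Lemma reduce_monomial (m : 'X_{1..n}) : ~~ standard m ->
  exists (i : 'I_r.+1) (m' : 'X_{1..n}), [/\ (1 < i)%N, m = (m' + mexp i)%MM &
    trinomial_proj ('X_[m] : P) =
      trinomial_const t (pencilX t i) * trinomial_proj ('X_[m' + mexp ord0] : P) +
                 trinomial_const t (pencilY t i) * trinomial_proj ('X_[m' + mexp (inord 1)] : P)].
Proof.
rewrite negb_forall => /existsP[i]; rewrite negb_imply negb_exists => /andP[i1 /forallP h].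
have mE : m = (m - mexp i + mexp i)%MM.
  rewrite submK //; apply/mnm_lepP => k; have [ki|/mexp_out->//] := eqVneq (tagnat.sig1 k) i.
  move: (h); rewrite -ki => {}h; rewrite -[k]tagnat.sig2K tagnat.Rank1K mexpE leqNgt.
  exact: h.
exists i, (m - mexp i)%MM; split=> //.
rewrite {1}mE !mpolyXD -!monomE !(rmorphM (@trinomial_proj K r t)) /=.
by rewrite [trinomial_proj (monom t i)]trinomial_proj_monom //; ring.
Qed.

(** The weight of T_ij is W/(n_i l_ij) with W = [block_weight], so that each f_i
    has weight W. *)
Definition block_weight : nat := (common_expo t * \prod_i blk t i)%N.
Definition var_weight (k : 'I_n) : nat :=
  (coexpo (tagnat.sig2 k) * (\prod_i blk t i %/ blk t (tagnat.sig1 k)))%N.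

Lemma prod_blk i : (\prod_i blk t i %/ blk t i * blk t i = \prod_i blk t i)%N.
Proof. by rewrite divnK // (bigD1 i) //= dvdn_mulr. Qed.

Lemma var_weight_gt0 k : (0 < var_weight k)%N.
Proof.
have pos : (0 < \prod_i blk t i)%N by apply: prodn_gt0 => i; apply: blk_gt0.
rewrite muln_gt0 coexpo_gt0 /= lt0n; apply/eqP => h.
by have := prod_blk (tagnat.sig1 k); rewrite h mul0n => e; rewrite -e in pos.
Qed.

Lemma weight_mexp_block i : weight var_weight (mexp i) = block_weight.
Proof.
rewrite weight_mexp; transitivity (\sum_(j < blk t i) common_expo t * (\prod_i blk t i %/ blk t i))%N.
  apply: eq_bigr => j _.
  rewrite /var_weight (tagnat_Rank (fun i j => coexpo j * (\prod_i blk t i %/ blk t i))%N).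
  by rewrite mulnAC coexpoK.
by rewrite sum_nat_const card_ord mulnCA [(blk t i * _)%N]mulnC prod_blk.
Qed.

Local Notation wt := (weight var_weight).

Definition weight_le (D : nat) (x : R) : Prop :=
  exists2 p : P, trinomial_proj p = x & forall m, m \in msupp p -> (wt m <= D)%N.

Definition in_span q (s : 'I_q -> R) (x : R) : Prop :=
  exists a : 'I_q -> K, x = \sum_(i < q) trinomial_const t (a i) * s i.

Lemma in_spanD q (s : 'I_q -> R) x y : in_span s x -> in_span s y -> in_span s (x + y).
Proof.
move=> [a ->] [b ->]; exists (fun i => a i + b i); rewrite -big_split /=.
by apply: eq_bigr => i _; rewrite rmorphD mulrDl.
Qed.

Lemma in_spanZ q (s : 'I_q -> R) c x : in_span s x -> in_span s (trinomial_const t c * x).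
Proof.
move=> [a ->]; exists (fun i => c * a i); rewrite mulr_sumr.
by apply: eq_bigr => i _; rewrite rmorphM mulrA.
Qed.

Lemma in_span_id q (s : 'I_q -> R) i : in_span s (s i).
Proof.
exists (fun k => (k == i)%:R); rewrite (bigD1 i) //= eqxx rmorph1 mul1r big1 ?addr0 //.
by move=> k /negPf->; rewrite rmorph0 mul0r.
Qed.

(** Replacing a factor f_i, i >= 2, by x_i f_0 + y_i f_1 keeps the weight and lowers
    the total degree mu in the blocks i >= 2. *)
Lemma standard_span D q (s : 'I_q -> R) :
  (forall m : 'X_{1..n}, standard m -> (wt m <= D)%N -> in_span s (trinomial_proj ('X_[m] : P))) ->
  forall m : 'X_{1..n}, (wt m <= D)%N -> in_span s (trinomial_proj ('X_[m] : P)).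
Proof.
move=> H m; pose mu := @weight n (fun k => nat_of_bool (1 < @tagnat.sig1 _ (blk t) k)%N).
elim/ltn_ind: (mu m) {-2}m (erefl (mu m)) => N IH {}m muE wm.
have [/H|/reduce_monomial[i [m' [i1 mE ->]]]] := boolP (standard m); first exact.
have lt k : (k <= 1)%N -> (mu (m' + mexp (inord k))%MM < N)%N.
  move=> k1; rewrite -muE mE /mu !weightD ltn_add2l !weight_mexp.
  rewrite big1 => [|j _]; last first.
    by rewrite tagnat.Rank1K inordK ?ltnS ?(leq_trans k1) // ltnNge k1.
  rewrite (bigD1 (Ordinal (blk_gt0 t i))) //= tagnat.Rank1K i1 mul1n.
  by rewrite addn_gt0 expo_gt0.
have wle k : (wt (m' + mexp k)%MM <= D)%N.
  by move: wm; rewrite mE !weightD !weight_mexp_block.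
have inord0 : inord 0 = ord0 :> 'I_r.+1 by apply: val_inj; rewrite /= inordK.
apply: in_spanD; apply: in_spanZ.
  by apply: (IH _ (lt 0%N _)); rewrite ?inord0.
by apply: (IH _ (lt 1%N _)).
Qed.

(** For each of the r - 1 blocks i >= 2 a standard monomial has a variable, selected
    by sel, whose exponent is below l_ij <= M; the other n - (r - 1) exponents are
    arbitrary in [0, D]. *)
Lemma card_standard (D : nat) :
  (#|[set m : {ffun 'I_n -> 'I_D.+1} | standard (fun k => m k)]| <=
   #|{ffun 'I_r.-1 -> 'I_n}| * common_expo t ^ r.-1 * D.+1 ^ (n - r.-1))%N.
Proof.
pose valid (sel : {ffun 'I_r.-1 -> 'I_n}) :=
  [forall l : 'I_r.-1, tagnat.sig1 (sel l) == inord l.+2].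
pose J (sel : {ffun 'I_r.-1 -> 'I_n}) := [set sel l | l : 'I_r.-1].
pose box (A : {set 'I_n}) := [set m : {ffun 'I_n -> 'I_D.+1} |
  [forall k in A, (m k < common_expo t)%N]].
rewrite -sum1_card; set U := [set m | _].
have Usel m : m \in U -> exists2 sel, valid sel & m \in box (J sel).
  rewrite inE => /forallP std.
  have /choice[sel selP] (l : 'I_r.-1) : exists k : 'I_n,
      tagnat.sig1 k = inord l.+2 /\ (m k < common_expo t)%N.
    have := std (inord l.+2); rewrite inordK; last by have := ltn_ord l; lia.
    move=> /existsP[j mj]; exists (tagnat.Rank _ j); rewrite tagnat.Rank1K; split=> //.
    by apply: leq_trans mj _; rewrite dvdn_leq ?common_expo_gt0 ?dvdn_common_expo.
  exists (finfun sel); first by apply/forallP => l; rewrite ffunE (selP l).1.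
  rewrite inE; apply/forallP => k; apply/implyP => /imsetP[l _ ->].
  by rewrite ffunE (selP l).2.
apply: (@leq_trans (\sum_(m in U) \sum_(sel | valid sel) (m \in box (J sel)))).
  apply: leq_sum => m /Usel[sel vs mb].
  by rewrite (bigD1 sel) //= mb.
rewrite exchange_big /= -mulnA -sum_nat_const.
rewrite [leqRHS](bigID valid) /=; apply: leq_trans (leq_addr _ _).
apply: leq_sum => sel /forallP vs.
have cJ : #|J sel| = r.-1.
  rewrite card_imset ?card_ord // => l l' e.
  have := eqP (vs l'); rewrite -e (eqP (vs l)) => /(congr1 val) /=.
  have := ltn_ord l; have := ltn_ord l' => h h'.
  by rewrite !inordK; [move=> [] /val_inj|lia|lia].
have := card_truncated_box D (common_expo t) (J sel); rewrite cJ; apply: leq_trans.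
rewrite -/(box _) -sum1_card [leqRHS]big_mkcond [leqLHS]big_mkcond.
by apply: leq_sum => m _; case: (m \in U); case: (m \in box _).
Qed.

Lemma nvars_ge : (r < n)%N.
Proof.
rewrite /nvars -[X in (X <= _)%N](card_ord r.+1) -sum1_card.
by apply: leq_sum => i _; apply: blk_gt0.
Qed.

Lemma trinomial_dim_le (e : nat) (p : 'I_e.+1 -> prime_idealr R) :
  prime_chain p -> (e <= n - r.-1)%N.
Proof.
apply: (@dim_bound K R (@trinomial_const K r t) weight_le
  (#|{ffun 'I_r.-1 -> 'I_n}| * common_expo t ^ r.-1)).
- move=> x; have [q <-] := trinomial_proj_surj x; exists (\max_(m <- msupp q) wt m), q => // m mq.
  by rewrite (big_rem m) //= leq_maxl.
- exists 1; first by rewrite rmorph1.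
  by move=> m; rewrite msupp1 inE => /eqP->; rewrite weight0.
- by move=> D D' x le [q qx qD]; exists q => // m /qD h; apply: leq_trans le.
- move=> D D' x y [q qx qD] [q' qy qD']; exists (q * q'); first by rewrite rmorphM /= qx qy.
  move=> m /msuppM_le/allpairsP[[m1 m2] [/= /qD h1 /qD' h2 ->]].
  by rewrite weightD leq_add.
move=> D; pose U := [set m : {ffun 'I_n -> 'I_D.+1} | standard (fun k => m k)].
pose s (i : 'I_#|U|) := trinomial_proj ('X_[ [multinom (enum_val i k : nat) | k < n] ] : P).
exists #|U|, s; split=> [|x [q <- qD]]; first exact: card_standard.
suff H (m : 'X_{1..n}) : standard m -> (wt m <= D)%N -> in_span s (trinomial_proj ('X_[m] : P)).
  rewrite (mpolyE q) rmorph_sum big_seq; elim/big_rec: _ => [|m y /qD mD IH].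
    by exists (fun=> 0); rewrite big1 // => i _; rewrite rmorph0 mul0r.
  by apply: in_spanD => //; rewrite /= trinomial_projZ; apply/in_spanZ/(standard_span H).
move=> std wm.
have mk k : (m k < D.+1)%N.
  rewrite ltnS; apply: leq_trans wm; rewrite /weight (bigD1 k) //=.
  by apply: leq_trans (leq_addr _ _); rewrite leq_pmull // var_weight_gt0.
pose m' : {ffun 'I_n -> 'I_D.+1} := [ffun k => Ordinal (mk k)].
have m'U : m' \in U.
  rewrite inE; apply/forallP => i; apply/implyP => i1.
  have /existsP[j mj] := implyP (forallP std i) i1.
  by apply/existsP; exists j; rewrite ffunE.
suff <- : s (enum_rank_in m'U m') = trinomial_proj 'X_[m] by apply: in_span_id.
rewrite /s enum_rankK_in //; congr (trinomial_proj 'X_[_]).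
by apply/mnmP => k; rewrite mnmE ffunE.
Qed.
End DimensionBound.

(** * A maximal chain of primes *)

Lemma kernel_prime (S D : comNzRingType) (f : {rmorphism S -> D}) : domain D ->
  exists p : prime_idealr S, forall x, (x \in p) = (f x == 0).
Proof.
move=> domD; pose I (x : S) := f x == 0.
have Icl : idealr_closed I.
  split=> [||a x y]; rewrite !unfold_in /I ?rmorph0 ?eqxx ?rmorph1 ?oner_neq0 //.
  by rewrite rmorphD rmorphM => /eqP-> /eqP->; rewrite mulr0 addr0.
have Ipr : prime_idealr_closed I.
  by move=> x y; rewrite !unfold_in /I rmorphM => /eqP/domD.
pose A := isIdealr.Build S I Icl.
pose B := isPrimeIdealrClosed.Build S I Ipr.
pose p : prime_idealr S := HB.pack I A B.
by exists p.
Qed.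

Lemma exists_root (K : closedFieldType) (a : K) n : (0 < n)%N -> exists x, x ^+ n = a.
Proof.
move=> n0; have [x xE] := @solve_monicpoly K n (fun i => if i == 0%N then a else 0) n0.
exists x; rewrite xE; case: n n0 {xE} => // n _.
by rewrite big_ord_recl /= mulr1 big1 ?addr0 // => i _; rewrite mul0r.
Qed.

Section KillVariables.
Variables (K : fieldType) (n : nat).
Local Notation P := {mpoly K[n]}.

Definition kill (s : seq 'I_n) : {rmorphism P -> P} :=
  mmap (@mpolyC n K) (fun k => if k \in s then 0 else 'X_k).

Lemma killX s k : kill s 'X_k = if k \in s then 0 else 'X_k.
Proof. by rewrite /kill /= mmapX mmap1U. Qed.

Lemma killC s c : kill s c%:MP = c%:MP.
Proof. by rewrite /kill /= mmapC. Qed.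

Lemma kill_comp s s' : {subset s <= s'} -> forall p, kill s' (kill s p) = kill s' p.
Proof.
move=> ss; apply: (@rmorph_mpoly_ext _ _ _ (kill s' \o kill s) (kill s')) => [a|k] /=.
  by rewrite !killC.
rewrite killX; case: ifP => [/ss ks|_] //.
by rewrite killX ks rmorph0.
Qed.

Lemma kill_nil p : kill [::] p = p.
Proof. by apply: (@rmorph_mpoly_ext _ _ _ (kill [::]) idfun) => [a|k]; rewrite ?killC ?killX. Qed.

Lemma kill_monomial s k (m : 'X_{1..n}) : k \in s -> (0 < m k)%N -> kill s 'X_[m] = 0.
Proof.
move=> ks mk; rewrite mpolyXE_id rmorph_prod (bigD1 k) //= rmorphXn /= killX ks.
by rewrite expr0n eqn0Ngt mk mul0r.
Qed.
End KillVariables.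
Arguments kill {K n} s.

Section Chain.
Variables (K : closedFieldType) (r : nat) (t : trinomial_data K r).
Hypothesis r_gt0 : (0 < r)%N.
Local Notation n := (nvars t).
Local Notation P := {mpoly K[n]}.
Local Notation R := (trinomial_ring t).
Local Notation M := (common_expo t).

Definition first_var i : 'I_(blk t i) := Ordinal (blk_gt0 t i).

Lemma prod_block (A : comNzRingType) i (F : 'I_(blk t i) -> A) :
  \prod_j F j = F (first_var i) * \prod_(j < blk t i | (0 < j)%N) F j.
Proof.
by rewrite (bigD1 (first_var i)) //=; congr (_ * _); apply: eq_bigl => j; rewrite lt0n.
Qed.

(** There is a point of Spec R with f_0 = 1 and f_1 = 0; T_00 does not vanish
    there. *)
Lemma first_var_neq0 : trinomial_proj (Tvar t _ (first_var ord0)) != 0.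
Proof.
have /choice[w wE] (i : 'I_r.+1) : exists x, x ^+ expo t i (first_var i) = pencilX t i.
  by apply: exists_root; apply: expo_gt0.
have [|h [_ hT]] := @trinomial_lift K r t K idfun
    (fun i j => if j == 0%N then w (inord i) else 1) 1 0.
  move=> i; rewrite prod_block /= inord_val wE big1 ?mulr1 ?mulr0 ?addr0 //.
  by move=> j; rewrite lt0n => /negPf->; rewrite expr1n.
apply/eqP => e; have := hT _ (first_var ord0); rewrite e rmorph0 /=.
have -> : inord 0 = ord0 :> 'I_r.+1 by apply: val_inj; rewrite /= inordK.
move=> w0; have /eqP := wE ord0; rewrite -w0 pencilX0 // expr0n eqn0Ngt expo_gt0 /=.
by rewrite eq_sym oner_eq0.
Qed.

(** The exponent vector of f_i / T_i0^l_i0. *)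
Definition tail_mexp (i : 'I_r.+1) : 'X_{1..n} :=
  (\sum_(j < blk t i | (0 < j)%N) U_(tagnat.Rank i j) *+ expo t i j)%MM.

Lemma tail_mexp_le i k : (tail_mexp i k <= M)%N.
Proof.
apply: (@leq_trans (mexp t i k)).
  rewrite /tail_mexp /mexp !mnm_sumE [leqRHS](bigID (fun j : 'I_(blk t i) => 0 < j)%N) /=.
  exact: leq_addr.
have [ki|ki] := eqVneq (tagnat.sig1 k) i; last by rewrite mexp_out.
rewrite -[k]tagnat.sig2K -ki mexpE dvdn_leq ?common_expo_gt0 //.
exact: dvdn_common_expo.
Qed.

Lemma tail_mexp_out i k : tagnat.sig1 k != i -> tail_mexp i k = 0%N.
Proof.
move=> ki; rewrite /tail_mexp mnm_sumE big1 // => j _; rewrite mulmnE mnm1E.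
by case: eqP => // e; move: ki; rewrite -e tagnat.Rank1K eqxx.
Qed.

Definition cotail_mexp i : 'X_{1..n} := [multinom (M - tail_mexp i k)%N | k < n].

Lemma cotail_mexpK i : (cotail_mexp i + tail_mexp i)%MM = [multinom M | k < n].
Proof. by apply/mnmP => k; rewrite mnmDE !mnmE subnK // tail_mexp_le. Qed.

(** Parametrization of a component of T_00 = 0.  There f_0 = 0 and f_i = y_i f_1.
    Let T_ij = X_ij^M for j > 0 and f_1 = (prod_k X_k)^(M^2), the product being over
    all variables; then T_i0^l_i0 must be y_i times the M-th power of the monomial
    [cotail_mexp i], which is an l_i0-th power because l_i0 divides M.  The constant
    w is the l_10-th root of y_1 = 1. *)
Lemma divisor_map : exists (h : {rmorphism R -> P}) (w : K),
  [/\ forall i (j : 'I_(blk t i)), (0 < j)%N ->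
        h (trinomial_proj (Tvar t i j)) = 'X_(tagnat.Rank i j) ^+ M,
      h (trinomial_proj (Tvar t _ (first_var ord0))) = 0, w != 0 &
      h (trinomial_proj (Tvar t _ (first_var (inord 1)))) =
        w%:MP * 'X_[cotail_mexp (inord 1)] ^+ coexpo (first_var (inord 1))].
Proof.
have /choice[w wE] (i : 'I_r.+1) : exists x, x ^+ expo t i (first_var i) = pencilY t i.
  by apply: exists_root; apply: expo_gt0.
pose v i (j : 'I_(blk t i)) : P := if (0 < j)%N then 'X_(tagnat.Rank i j) ^+ M
  else (w i)%:MP * 'X_[cotail_mexp i] ^+ coexpo j.
have inord0 : inord 0 = ord0 :> 'I_r.+1 by apply: val_inj; rewrite /= inordK.
have [|h [_ hT]] := @trinomial_lift K r t P (@mpolyC n K) (totalize 0 v)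
    0 ('X_[ [multinom M | k < n] ] ^+ M).
  move=> i; rewrite mulr0 add0r prod_block totalizeE /v /= exprMn -exprM coexpoK.
  rewrite -rmorphXn /= wE -mulrA; congr (_ * _); rewrite -(cotail_mexpK i) mpolyXD exprMn.
  congr (_ * _); rewrite /tail_mexp -mprodXnE -prodrXl; apply: eq_bigr => j j0.
  by rewrite totalizeE j0 -!exprM mulnC.
exists h, (w (inord 1)); split.
- by move=> i j j0; rewrite hT totalizeE /v j0.
- rewrite hT totalizeE /v /=; have /eqP := wE ord0; rewrite pencilY0 expf_eq0 => /andP[_ /eqP->].
  by rewrite mpolyC0 mul0r.
- have := wE (inord 1); rewrite pencilY1 //; apply: contra_eq_neq => ->.
  by rewrite expr0n eqn0Ngt expo_gt0 eq_sym oner_eq0.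
- by rewrite hT totalizeE /v.
Qed.

Lemma card_tail_vars : #|[set k : 'I_n | (0 < tagnat.sig2 k)%N]| = (n - r.+1)%N.
Proof.
have -> : [set k : 'I_n | (0 < tagnat.sig2 k)%N] =
    ~: [set tagnat.Rank i (first_var i) | i : 'I_r.+1].
  apply/setP => k; rewrite !inE; apply/idP/idP => [k0|].
    apply/negP => /imsetP[i _ kE].
    by move: k0; rewrite kE (tagnat_Rank (fun i j => 0 < j)%N).
  apply: contraR; rewrite -leqNgt leqn0 => /eqP k0; apply/imsetP; exists (tagnat.sig1 k) => //.
  by rewrite -[LHS]tagnat.sig2K; congr tagnat.Rank; apply: val_inj.
rewrite cardsCs setCK card_imset ?card_ord // => i i' /(congr1 (@tagnat.sig1 _ (blk t))).
by rewrite !tagnat.Rank1K.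
Qed.

(** After 0 comes the kernel of [divisor_map]; the next primes are the kernels of its
    composites with the maps that set to zero first X_00, which kills T_10, and then
    the X_ij with j > 0 one at a time, each of which kills T_ij. *)
Lemma trinomial_chain (domR : domain R) :
  exists p : 'I_(n - r.-1).+1 -> prime_idealr R, prime_chain p.
Proof.
have [h [w [hT h0 w0 h1]]] := divisor_map.
pose v0 := tagnat.Rank ord0 (first_var ord0).
pose vs := v0 :: enum [set k : 'I_n | (0 < tagnat.sig2 k)%N].
have svs : size vs = (n - r)%N.
  by rewrite /= -cardE card_tail_vars; have := nvars_ge t; lia.
have uvs : uniq vs.
  rewrite /= enum_uniq andbT mem_enum inE.
  by rewrite (tagnat_Rank (fun i j => 0 < j)%N).
have domP : domain P := @idomain_domain _.
have [g gE] : exists g : nat -> {rmorphism R -> P}, forall l x, g l x = kill (take l vs) (h x).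
  by exists (fun l => kill (take l vs) \o h).
have /choice[p pE] (k : 'I_(n - r.-1).+1) : exists p : prime_idealr R,
    forall x, (x \in p) = if val k is l.+1 then g l x == 0 else x == 0.
  case: k => -[|l] /= _; first exact: (@kernel_prime R R idfun domR).
  exact: (@kernel_prime R P (g l) domP).
exists p => -[k kd] [l ld] /= kl.
split=> [x|].
  rewrite !pE /=; case: k kd kl => [|k] kd; case: l ld => // l ld.
    by move=> _ /eqP->; rewrite !rmorph0.
  rewrite ltnS => kl; rewrite !gE => /eqP e; apply/eqP.
  have ss : {subset take k vs <= take l vs}.
    by move=> x'; rewrite -(subnKC (ltnW kl)) takeD mem_cat => ->.
  exact: etrans (esym (kill_comp ss (h x))) (etrans (congr1 (kill (take l vs)) e) (rmorph0 _)).
case: l ld kl => // l ld; case: k kd => [|k] kd kl.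
  exists (trinomial_proj (Tvar t _ (first_var ord0))); rewrite pE /=; last exact: first_var_neq0.
  by rewrite gE h0 rmorph0.
have kvs : (k < size vs)%N by rewrite svs; have := nvars_ge t; lia.
pose u := nth v0 vs k.
have uin : u \in take l vs.
  by rewrite -[u](nth_take _ (kl : k < l)%N) mem_nth // size_take_min leq_min kvs andbT.
have uout : u \notin take k vs by rewrite in_take ?mem_nth // index_uniq // ltnn.
case: k => [|k] in kd kl kvs u uin uout *.
  exists (trinomial_proj (Tvar t _ (first_var (inord 1)))); rewrite pE /= gE h1.
    rewrite rmorphM rmorphXn /= (kill_monomial K uin).
      by rewrite expr0n eqn0Ngt coexpo_gt0 mulr0.
    rewrite /u /= mnmE tail_mexp_out ?subn0 ?common_expo_gt0 //.
    by rewrite tagnat.Rank1K i01_neq.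
  rewrite take0 kill_nil mulf_neq0 ?mpolyC_eq0 // expf_neq0 //.
  by rewrite -msupp_eq0 msuppX.
have u2 : (0 < tagnat.sig2 u)%N.
  have : u \in enum [set k : 'I_n | (0 < tagnat.sig2 k)%N] by apply: mem_nth.
  by rewrite mem_enum inE.
exists (trinomial_proj (Tvar t _ (tagnat.sig2 u))); rewrite pE /= gE hT // tagnat.sig2K rmorphXn /= killX.
  by rewrite uin expr0n eqn0Ngt common_expo_gt0.
by rewrite (negPf uout) expf_neq0 // -msupp_eq0 msuppX.
Qed.

Lemma trinomial_krull_dim (domR : domain R) : krull_dim R (n - r.-1).
Proof. by split; [exact: trinomial_chain|exact: trinomial_dim_le]. Qed.
End Chain.

(** * Complete intersection *)

Lemma trinomial_complete_intersection (K : fieldType) (r : nat) (t : trinomial_data K r) :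
  (0 < r)%N -> krull_dim (trinomial_ring t) (nvars t - r.-1) ->
  complete_intersection (trinomial_scalar t).
Proof.
move=> r0 dimR; exists (nvars t), r.-1, (@relation K r t), (@trinomial_proj K r t); split=> //.
- exact: trinomial_proj_surj.
- exact: trinomial_proj_ker.
- by exists (nvars t - r.-1)%N => //; have := nvars_ge t; lia.
Qed.

Local Close Scope ring_scope.
Theorem proposition1p2 (K : closedFieldType) (charK : [pchar K]%R =i pred0)
    (r : nat) (r_gt0 : 0 < r) (t : trinomial_data K r) :
  [/\ normal_domain (trinomial_ring t),
      complete_intersection (trinomial_scalar t)
    & krull_dim (trinomial_ring t) (\sum_(i < r.+1) blk t i - r + 1)].
Proof.
have [domR cicR] := trinomial_domain_cic t r_gt0 charK.
have dimR := trinomial_krull_dim r_gt0 domR.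
split; first exact: cic_normal_domain.
  exact: trinomial_complete_intersection.
suff -> : (\sum_(i < r.+1) blk t i - r + 1 = nvars t - r.-1)%N by [].
by have := nvars_ge t; rewrite /nvars; lia.
Qed.
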